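(* Let $r\ge 1$ and let $q\in\mathbb{C}$ be a primitive $r$-th root of unity. Let $\mathbf{Sym}$ be the algebra of noncommutative symmetric functions over $\mathbb{C}$, with internal product $*$. Let $\mathring{\mathcal P}=\theta_q(\mathbf{Sym})$ be the image of the algebra endomorphism $\theta_q: f\mapsto f((1-q)A)$ of $\mathbf{Sym}$, and let $\mathcal P=\sum_{n\ge 0} S_n\,\mathring{\mathcal P}$ be the right $\mathring{\mathcal P}$-module (for the ordinary product of $\mathbf{Sym}$) generated by the $S_n$, $n\ge 0$. Then $\mathcal P$ is a unital $*$-subalgebra of $\mathbf{Sym}$. Its Hilbert series is $$\sum_{n\ge 0}\dim \mathcal P_n\, t^n=\frac{1}{1-t-t^2-\cdots-t^r},$$ where $\mathcal P_n$ denotes the homogeneous component of degree $n$ of $\mathcal P$.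
   Context: $\mathbf{Sym}$ is the free associative unital $\mathbb{C}$-algebra on generators $S_1,S_2,\dots$ with $\deg S_n=n$ and $S_0=1$. For a finite sequence $I=(i_1,\dots,i_k)$ of positive integers, $S^I=S_{i_1}\cdots S_{i_k}$; the $S^I$ form a linear basis. $\mathbf{Sym}_n$ is the homogeneous component of degree $n$. $\mathbf{Sym}$ is a graded bialgebra (Hopf algebra) for the algebra morphism $\Delta$ with $\Delta S_n=\sum_{i+j=n}S_i\otimes S_j$. The elementary functions $\Lambda_n$ are defined by $\Lambda_0=1$ and $\sum_{i+j=n}(-1)^i\Lambda_i S_j=0$ for $n\ge 1$. The internal product $*$ is the bilinear associative product on $\mathbf{Sym}$ such that $f*g=0$ if $f,g$ are homogeneous of different degrees, $S_n$ is the neutral element of $(\mathbf{Sym}_n,* )$ for each $n$, and the splitting formula holds: $(f_1\cdots f_k)*g=\mu_k\big((f_1\otimes\cdots\otimes f_k)*_k\Delta^k g\big)$ for $f_1,\dots,f_k,g\in\mathbf{Sym}$, where $\Delta^k$ is the iterated coproduct with values in $\mathbf{Sym}^{\otimes k}$, $*_k$ is the componentwise internal product on $\mathbf{Sym}^{\otimes k}$, and $\mu_k$ is the $k$-fold ordinary multiplication. (Each $(\mathbf{Sym}_n,* )$ is anti-isomorphic to the Solomon descent algebra of the symmetric group $\mathfrak S_n$.) The endomorphism $\theta_q$, $f\mapsto f((1-q)A)$, is the algebra endomorphism of $\mathbf{Sym}$ (ordinary product) given by $$\theta_q(S_n)=S_n((1-q)A)=\sum_{i+j=n}(-q)^i\Lambda_i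 S_j\qquad(n\ge 0).$$ Equivalently $\theta_q(f)=f*\sum_{n\ge0} S_n((1-q)A)$. ''Unital $*$-subalgebra'' is understood degree by degree: $\mathcal P$ is a graded subspace of $\mathbf{Sym}$ stable under $*$, and each $\mathcal P_n=\mathcal P\cap\mathbf{Sym}_n$ contains the unit $S_n$ of $(\mathbf{Sym}_n,* )$ (the formal neutral element is $\sigma_1=\sum_{n\ge0}S_n$). *)

(* Defs.v *)
From HB Require Import structures.
From mathcomp Require Import all_boot all_order all_algebra.
From mathcomp Require Import finmap.
From mathcomp Require Export reals complex.
From mathcomp Require Export multinomials.monalg.

Set Implicit Arguments.
Unset Strict Implicit.
Unset Printing Implicit Defensive.

Import GRing.Theory.
Local Open Scope ring_scope.

(* Pairs of monomials multiply componentwise, so that the monoid algebra of   *)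
(* M * N is the tensor product of the monoid algebras of M and N.             *)
Section PairMonomial.
Variables M N : monomType.
Implicit Types x y z : (M * N)%type.

Definition pair_mone : (M * N)%type := (mone, mone).
Definition pair_mmul x y : (M * N)%type := (mmul x.1 y.1, mmul x.2 y.2).

Fact pair_mmulA : associative pair_mmul.
Proof. by move=> x y z; rewrite /pair_mmul !mulmA. Qed.

Fact pair_mmul1m : left_id pair_mone pair_mmul.
Proof. by case=> x y; rewrite /pair_mmul !mul1m. Qed.

Fact pair_mmulm1 : right_id pair_mone pair_mmul.
Proof. by case=> x y; rewrite /pair_mmul !mulm1. Qed.

Fact pair_mmul_eq1 x y :
  pair_mmul x y = pair_mone -> x = pair_mone /\ y = pair_mone.
Proof. by case: x y => [x1 x2] [y1 y2] [/unitm[-> ->] /unitm[-> ->]]. Qed.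

HB.instance Definition _ := Choice_isMonomialDef.Build (M * N)%type
  pair_mmulA pair_mmul1m pair_mmulm1 pair_mmul_eq1.

End PairMonomial.

(* The letter i of a word stands for S_(i.+1), so the word [:: i1; ..; ik] is *)
(* the composition (i1.+1, .., ik.+1).                                        *)
Notation word := {fmonom nat}.
Notation Sym K := {malg K[word]}.

(* The tensor square and the k-th tensor power of Sym. *)
Notation Sym2 K := {malg K[(word * word)%type]}.
Notation TSym K k := {malg K[k.-tuple word]}.

Section LinearExtension.
Variables (K : fieldType) (B : choiceType) (V : lmodType K).

Definition lin (h : B -> V) (f : {malg K[B]}) : V :=
  \sum_(b <- msupp f) f@_b *: h b.

End LinearExtension.

Section Sym.
Variable K : fieldType.
Implicit Types (f g : Sym K) (w : word).

Definition Sf (n : nat) : Sym K := if n is m.+1 then << fmu m >> else 1.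

Definition wdeg w : nat := (\sum_(i <- (w : seq nat)) i.+1)%N.

(* Sym_n *)
Definition homog (n : nat) f : Prop :=
  forall w, w \in msupp f -> wdeg w = n.

Definition hcomp (n : nat) f : Sym K :=
  \sum_(w <- msupp f | wdeg w == n) << f@_w *g w >>.

(* The algebra morphism from Sym that maps S_n to v n, for n >= 1. *)
Definition alg_ext (A : lalgType K) (v : nat -> A) : Sym K -> A :=
  lin (fun w => \prod_(i <- (w : seq nat)) v i.+1).

(* f (x) g in Sym (x) Sym *)
Definition tensor2 f g : Sym2 K :=
  lin (fun u => lin (fun w => << (u, w) >>) g) f.

Definition Delta : Sym K -> Sym2 K :=
  alg_ext (fun n => \sum_(i < n.+1) tensor2 (Sf i) (Sf (n - i))).

(* f (x) T in Sym^(x)(k+1), for T in Sym^(x)k *)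
Definition tcons k f (T : TSym K k) : TSym K k.+1 :=
  lin (fun u => lin (fun t : k.-tuple word => << [tuple of u :: t] >>) T) f.

(* f_1 (x) .. (x) f_k *)
Fixpoint tensor k : k.-tuple (Sym K) -> TSym K k :=
  match k return k.-tuple (Sym K) -> TSym K k with
  | 0 => fun=> << [tuple] >>
  | k'.+1 => fun s => tcons (thead s) (tensor [tuple of behead s])
  end.

(* Iterated coproduct: Delta^0 is the counit and                              *)
(* Delta^(k+1) = (id (x) Delta^k) o Delta, whence Delta^1 = id.               *)
Fixpoint Deltak k : Sym K -> TSym K k :=
  match k return Sym K -> TSym K k with
  | 0 => fun g => g@_mone *: << [tuple] >>
  | k'.+1 => fun g =>
      lin (fun p => tcons << p.1 >> (Deltak k' << p.2 >>)) (Delta g)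
  end.

Definition mu k : TSym K k -> Sym K :=
  lin (fun t : k.-tuple word => \prod_(w <- t) << w >>).

Definition tstar (star : Sym K -> Sym K -> Sym K) k (T U : TSym K k) :
    TSym K k :=
  lin (fun t : k.-tuple word =>
    lin (fun u : k.-tuple word =>
      tensor [tuple star << tnth t i >> << tnth u i >> | i < k]) U) T.

Record is_internal_product (star : Sym K -> Sym K -> Sym K) : Prop := {
  star_linearl : forall g, linear (star^~ g);
  star_linearr : forall f, linear (star f);
  star_assoc : associative star;
  star_neq_deg : forall m n f g,
    homog m f -> homog n g -> m <> n -> star f g = 0;
  star_S_left : forall n g, homog n g -> star (Sf n) g = g;
  star_S_right : forall n f, homog n f -> star f (Sf n) = f;
  star_splitting : forall k (f : k.-tuple (Sym K)) g,
    star (\prod_(i < k) tnth f i) g =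
    mu (tstar star (tensor f) (Deltak k g))
}.

(* [:: Lambda_0; ..; Lambda_n], from the defining relation solved for         *)
(* Lambda_n; see Lambda_rel.                                                  *)
Fixpoint Lambdas (n : nat) : seq (Sym K) :=
  if n is m.+1 then
    rcons (Lambdas m)
      (\sum_(i < n) (-1) ^+ (m - i) *: ((Lambdas m)`_i * Sf (n - i)))
  else [:: 1].

Definition Lambda (n : nat) : Sym K := (Lambdas n)`_n.

Definition theta (q : K) : Sym K -> Sym K :=
  alg_ext (fun n => \sum_(i < n.+1) (- q) ^+ i *: (Lambda i * Sf (n - i))).

(* The image of theta. *)
Definition Pring (q : K) f : Prop := exists g, f = theta q g.

(* The right Pring-module generated by the S_n. *)
Definition Pmod (q : K) f : Prop :=
  exists N (a : nat -> Sym K),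
    (forall n, Pring q (a n)) /\ f = \sum_(n < N) Sf n * a n.

Record unital_star_subalgebra (star : Sym K -> Sym K -> Sym K)
    (V : Sym K -> Prop) : Prop := {
  subalg0 : V 0;
  subalg_lin : forall (a : K) f g, V f -> V g -> V (a *: f + g);
  subalg_graded : forall n f, V f -> V (hcomp n f);
  subalg_star : forall f g, V f -> V g -> V (star f g);
  subalg_unit : forall n, V (Sf n)
}.

Definition has_dim (V : lmodType K) (W : V -> Prop) (d : nat) : Prop :=
  exists b : 'I_d -> V,
    [/\ forall i, W (b i),
        forall c : 'I_d -> K, \sum_i c i *: b i = 0 -> forall i, c i = 0
      & forall v, W v -> exists c : 'I_d -> K, v = \sum_i c i *: b i].

End Sym.

(* Formal power series over int, as coefficient sequences. *)
Definition series_mul (a b : nat -> int) (n : nat) : int :=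
  \sum_(i < n.+1) a i * b (n - i)%N.

Definition series_poly (p : {poly int}) (n : nat) : int := p`_n.

(* a = 1 / p in int[[t]] *)
Definition is_series_inverse (a : nat -> int) (p : {poly int}) : Prop :=
  series_mul a (series_poly p) =1 series_poly 1.

Section Lin.
Variable K : fieldType.

Section One.
Variables (B : choiceType) (V : lmodType K) (h : B -> V).

Lemma linEw (d : {fset B}) f : (msupp f `<=` d)%fset ->
  lin h f = \sum_(b <- d) f@_b *: h b.
Proof.
move=> le; rewrite /lin (big_fset_incl _ le) => //= x xd /mcoeff_outdom ->.
by rewrite scale0r.
Qed.

Lemma linU b : lin h << b >> = h b.
Proof. by rewrite (linEw msuppU_le) big_seq_fset1 mcoeffUU scale1r. Qed.

Lemma lin_is_linear : linear (lin h).
Proof.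
move=> a f g.
pose d := (msupp f `|` msupp g `|` msupp (a *: f + g))%fset.
have [df dg dfg]: [/\ msupp f `<=` d, msupp g `<=` d
    & msupp (a *: f + g) `<=` d]%fset.
  split; apply/fsubsetP => x xs; rewrite !in_fsetU xs ?orbT //.
rewrite (linEw df) (linEw dg) (linEw dfg) scaler_sumr -big_split /=.
by apply: eq_bigr => b _; rewrite mcoeffD mcoeffZ scalerDl scalerA.
Qed.

HB.instance Definition _ := GRing.isLinear.Build K {malg K[B]} V _ (lin h)
  lin_is_linear.

End One.

Lemma malgZE (B : choiceType) (f : {malg K[B]}) :
  f = \sum_(b <- msupp f) f@_b *: << b >>.
Proof.
rewrite {1}(monalgE f); apply: eq_bigr => b _.
by apply/malgP => k; rewrite mcoeffZ !mcoeffU mulr_natr.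
Qed.

Lemma lin_id (B : choiceType) (V : lmodType K) (phi : {linear {malg K[B]} -> V})
  f : phi f = lin (fun b => phi << b >>) f.
Proof.
rewrite {1}(malgZE f) linear_sum; apply: eq_bigr => b _.
by rewrite linearZ.
Qed.

Lemma linear_ext (B : choiceType) (V : lmodType K) (p1 p2 : {malg K[B]} -> V) :
  linear p1 -> linear p2 -> (forall b, p1 << b >> = p2 << b >>) -> p1 =1 p2.
Proof.
move=> l1 l2 e f.
pose q1 := GRing.isLinear.Build _ _ _ _ p1 l1.
pose q2 := GRing.isLinear.Build _ _ _ _ p2 l2.
pose r1 : {linear _ -> _} := HB.pack p1 q1.
pose r2 : {linear _ -> _} := HB.pack p2 q2.
rewrite -[p1 f]/(r1 f) -[p2 f]/(r2 f) (lin_id r1) (lin_id r2).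
by apply: eq_bigr => b _; rewrite /= e.
Qed.

Lemma eq_lin (B : choiceType) (V : lmodType K) (h1 h2 : B -> V) :
  h1 =1 h2 -> lin h1 =1 lin h2.
Proof. by move=> e f; apply: eq_bigr => b _; rewrite e. Qed.

Lemma lin_linear (B C : choiceType) (V : lmodType K) (h : B -> {malg K[C]} -> V)
  f : (forall b, linear (h b)) -> linear (fun g => lin (h^~ g) f).
Proof.
move=> hl a g g'; rewrite /lin scaler_sumr -big_split /=.
by apply: eq_bigr => b _; rewrite hl scalerDr !scalerA mulrC.
Qed.

End Lin.

Section LambdaRel.
Variable K : fieldType.

Lemma size_Lambdas n : size (Lambdas K n) = n.+1.
Proof. by elim: n => //= n IH; rewrite size_rcons IH. Qed.

Lemma nth_Lambdas n i : (i <= n)%N -> (Lambdas K n)`_i = Lambda K i.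
Proof.
elim: n => [|n IH]; first by rewrite leqn0 => /eqP->.
rewrite leq_eqVlt => /orP[/eqP-> //|lt].
by rewrite /= nth_rcons size_Lambdas lt IH.
Qed.

Lemma Lambda_rel n : (0 < n)%N ->
  \sum_(i < n.+1) (-1) ^+ i *: (Lambda K i * Sf K (n - i)) = 0.
Proof.
case: n => // n _; rewrite big_ord_recr /= subnn mulr1.
have -> : Lambda K n.+1 =
    \sum_(i < n.+1) (-1) ^+ (n - i) *: (Lambda K i * Sf K (n.+1 - i)).
  rewrite {1}/Lambda /= nth_rcons size_Lambdas ltnn eqxx.
  by apply: eq_bigr => i _; rewrite nth_Lambdas // -ltnS.
rewrite scaler_sumr -big_split big1 //= => i _.
rewrite scalerA -scalerDl -exprD -signr_odd -[X in _ + X]signr_odd.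
have le : (i <= n)%N by rewrite -ltnS.
rewrite oddD /= oddB //; case: (odd n); case: (odd i) => /=;
  by rewrite ?expr0 ?expr1 ?subrr ?addNr ?scale0r.
Qed.

End LambdaRel.

(* There is exactly one internal product: internal_product_exists and         *)
(* internal_product_unique.                                                   *)
Section InternalProduct.
Variable K : fieldType.
Implicit Types (u v w x y z : word) (f g : Sym K).

Definition Sw (n : nat) : word := if n is m.+1 then fmu m else mone.

Lemma SE n : Sf K n = << Sw n >>.
Proof. by case: n. Qed.

Lemma word_ind (Q : word -> Prop) :
  Q mone -> (forall n w, Q w -> Q (mmul (Sw n.+1) w)) -> forall w, Q w.
Proof.
move=> Q1 QS [s]; elim: s => [|i s IH].
  by have -> : FMonom (Nil nat) = mone by apply/val_inj; rewrite /= fm1.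
have -> : FMonom (i :: s) = mmul (Sw i.+1) (FMonom s)
  by apply/val_inj; rewrite /= fmM fmU.
exact: QS.
Qed.

Lemma wdeg1 : wdeg mone = 0%N.
Proof. by rewrite /wdeg fm1 big_nil. Qed.
Lemma wdegM u v : wdeg (mmul u v) = (wdeg u + wdeg v)%N.
Proof. by rewrite /wdeg fmM big_cat. Qed.
Lemma wdegS n : wdeg (Sw n) = n.
Proof. by case: n => [|n]; rewrite ?wdeg1 // /wdeg /= fmU big_seq1. Qed.
Lemma wdeg_eq0 w : (wdeg w == 0%N) = (w == mone).
Proof.
elim/word_ind: w => [|n w _]; first by rewrite wdeg1 !eqxx.
rewrite wdegM wdegS addSn /=; apply/esym/eqP => /unitm[e _].
by move: (congr1 wdeg e); rewrite (wdegS n.+1) wdeg1.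
Qed.

(* Delta << w >> is the sum of << (p.1, p.2) >> over p in wsplits w; see DeltaU. *)
Fixpoint wsplits (s : seq nat) : seq (word * word) :=
  if s is i :: s' then
    [seq (mmul (Sw a) p.1, mmul (Sw (i.+1 - a)) p.2) | a <- iota 0 i.+2, p <- wsplits s']
  else [:: (mone, mone)].

Section SumL.
Variable V : zmodType.
Implicit Types F : word -> word -> V.

Definition sumL w F : V := \sum_(p <- wsplits w) F p.1 p.2.

Lemma eq_sumL w F G : (forall x y, F x y = G x y) -> sumL w F = sumL w G.
Proof. by move=> e; apply: eq_bigr => p _; rewrite e. Qed.

Lemma sumL1 F : sumL mone F = F mone mone.
Proof. by rewrite /sumL fm1 big_seq1. Qed.

Lemma sumLS n w F : sumL (mmul (Sw n) w) F =
  \sum_(a < n.+1) sumL w (fun x y => F (mmul (Sw a) x) (mmul (Sw (n - a)) y)).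
Proof.
case: n => [|n].
  by rewrite big_ord1 /= mul1m; apply: eq_sumL => x y; rewrite !mul1m.
rewrite /sumL fmM fmU.
have -> : wsplits ([:: n] ++ (w : seq nat)) = [seq (mmul (Sw a) p.1, mmul (Sw (n.+1 - a)) p.2)
   | a <- iota 0 n.+2, p <- wsplits w] by [].
rewrite big_allpairs_dep -[iota 0 n.+2]/(index_iota 0 n.+2) big_mkord.
by [].
Qed.

Lemma sumL_deg w F G : (forall x y, (wdeg x + wdeg y = wdeg w)%N -> F x y = G x y) ->
  sumL w F = sumL w G.
Proof.
elim/word_ind: w F G => [|n w IH] F G e.
  by rewrite !sumL1 e // wdeg1.
rewrite !sumLS; apply: eq_bigr => a _; apply: IH => x y d.
by apply: e; rewrite !wdegM !wdegS -d addnACA subnKC // -ltnS.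
Qed.

Lemma sumL0 w : sumL w (fun _ _ => 0) = 0.
Proof. by rewrite /sumL big1. Qed.

Lemma sumL_sum w (I : Type) (r : seq I) (Q : pred I) (F : I -> word -> word -> V) :
  sumL w (fun x y => \sum_(i <- r | Q i) F i x y) = \sum_(i <- r | Q i) sumL w (F i).
Proof. exact: exchange_big. Qed.

Lemma sumL_swap u v (F : word -> word -> word -> word -> V) :
  sumL u (fun x y => sumL v (F x y)) = sumL v (fun a b => sumL u (fun x y => F x y a b)).
Proof. exact: exchange_big. Qed.

Lemma sumLC w F : sumL w F = sumL w (fun x y => F y x).
Proof.
elim/word_ind: w F => [|n w IH] F; first by rewrite !sumL1.
rewrite !sumLS (reindex_inj rev_ord_inj) /=; apply: eq_bigr => a _.
have le : (a <= n.+1)%N by rewrite -ltnS.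
by rewrite IH; apply: eq_sumL => x y; rewrite subSS subKn.
Qed.

Lemma sum_coassoc n (F : nat -> nat -> nat -> V) :
  \sum_(a < n.+1) \sum_(b < a.+1) F b (a - b)%N (n - a)%N =
  \sum_(a < n.+1) \sum_(b < (n - a).+1) F a b (n - a - b)%N.
Proof.
transitivity (\sum_(a < n.+1) \sum_(b < n.+1)
   if (b < a.+1)%N then F b (a - b)%N (n - a)%N else 0).
  apply: eq_bigr => a _; rewrite -big_mkcond.
  exact: (big_ord_widen_cond n.+1 xpredT (fun b => F b (a - b)%N (n - a)%N) (ltn_ord a)).
transitivity (\sum_(a < n.+1) \sum_(0 <= b < (n - a).+1) F a b (n - a - b)%N);
  last by apply: eq_bigr => a _; rewrite big_mkord.
rewrite exchange_big /=; apply: eq_bigr => b _.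
rewrite -big_mkcond /=.
rewrite -(big_mkord (fun a => (b < a.+1)%N) (fun a => F b (a - b)%N (n - a)%N)).
have le : (b <= n)%N by rewrite -ltnS.
rewrite (big_cat_nat (n := b)) ?(leqW le) //= [X in X + _]big_nat_cond big1 ?add0r; last first.
  by move=> i /andP[/andP[_ lt]]; rewrite ltnS leqNgt lt.
rewrite big_nat_cond -{1}[b : nat]add0n big_addn subSn //.
rewrite [LHS]big_nat_cond [RHS]big_nat_cond.
apply: eq_big => i; first by rewrite !ltnS ?leq_addl ?andbT /= addnC -leq_subRL ?andbb.
by move=> _; rewrite addnK addnC subnDA.
Qed.

Lemma sumLA w (F : word -> word -> word -> V) :
  sumL w (fun a b => sumL a (fun x y => F x y b)) =
  sumL w (fun a b => sumL b (fun x y => F a x y)).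
Proof.
elim/word_ind: w F => [|n w IH] F; first by rewrite !sumL1.
rewrite !sumLS.
under eq_bigr => a _.
  under eq_sumL => x y do rewrite sumLS.
  rewrite sumL_sum.
  under eq_bigr => b _ do rewrite
    (IH (fun x y z => F (mmul (Sw b) x) (mmul (Sw (a - b)) y) (mmul (Sw (n.+1 - a)) z))).
  over.
rewrite (sum_coassoc n.+1 (fun i j k => sumL w (fun a b => sumL b (fun x y =>
  F (mmul (Sw i) a) (mmul (Sw j) x) (mmul (Sw k) y))))).
by apply: eq_bigr => a _; under [RHS]eq_sumL => x y do rewrite sumLS; rewrite sumL_sum.
Qed.

Lemma sumL_counitl w (F : word -> V) :
  sumL w (fun x y => if x == mone then F y else 0) = F w.
Proof.
elim/word_ind: w F => [|n w IH] F; first by rewrite sumL1 eqxx.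
rewrite sumLS big_ord_recl big1 ?addr0 => [|i _].
  under eq_sumL => x y do rewrite mul1m subn0.
  exact: IH.
rewrite -[RHS](sumL0 w); apply: eq_sumL => x y; case: eqP => // e.
by move: (congr1 wdeg e); rewrite wdegM wdegS wdeg1.
Qed.

Lemma sumL_counitr w (F : word -> V) :
  sumL w (fun x y => if y == mone then F x else 0) = F w.
Proof. by rewrite sumLC sumL_counitl. Qed.

Lemma sumLM u v F : sumL (mmul u v) F =
  sumL u (fun x y => sumL v (fun a b => F (mmul x a) (mmul y b))).
Proof.
elim/word_ind: u F => [|n u IH] F.
  by rewrite sumL1 mul1m; apply: eq_sumL => x y; rewrite !mul1m.
rewrite -mulmA !sumLS; apply: eq_bigr => a _; rewrite IH.
by apply: eq_sumL => x y; apply: eq_sumL => s t; rewrite !mulmA.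
Qed.

Lemma sumL4 w (F : word -> word -> word -> word -> V) :
  sumL w (fun a b => sumL a (fun x y => sumL b (fun s t => F x y s t))) =
  sumL w (fun a b => sumL a (fun x y => sumL b (fun s t => F x s y t))).
Proof.
rewrite (sumLA w (fun x y b => sumL b (F x y))).
rewrite (sumLA w (fun x y b => sumL b (fun s t => F x s y t))).
apply: eq_sumL => a b.
rewrite -(sumLA b (fun y s t => F a y s t)) -(sumLA b (fun y s t => F a s y t)).
by apply: eq_sumL => c d; rewrite sumLC.
Qed.

End SumL.

Lemma sumL_linear (V W : lmodType K) (phi : V -> W) w F :
  linear phi -> phi (sumL w F) = sumL w (fun x y => phi (F x y)).
Proof.
move=> l; pose q := GRing.isLinear.Build _ _ _ _ phi l.
pose r : {linear _ -> _} := HB.pack phi q.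
exact: (linear_sum r).
Qed.

Fixpoint starw (s : seq nat) (v : word) : Sym K :=
  if s is i :: s' then
    sumL v (fun x y => if wdeg x == i.+1 then << x >> * starw s' y else 0)
  else if v == mone then 1 else 0.

Lemma starw1 v : starw (mone : word) v = if v == mone then 1 else 0.
Proof. by rewrite fm1. Qed.

Lemma starwS n w v : starw (mmul (Sw n) w) v =
  sumL v (fun x y => if wdeg x == n then << x >> * starw w y else 0).
Proof.
case: n => [|n]; last by rewrite fmM fmU.
rewrite mul1m -[LHS](sumL_counitl v); apply: eq_sumL => x y.
by rewrite wdeg_eq0; case: eqP => // ->; rewrite mul1r.
Qed.

Lemma mulr_linear_r (A : lalgType K) (a : A) : linear ( *%R^~ a).
Proof. by move=> c x y; rewrite mulrDl scalerAl. Qed.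

Lemma UM (M : monomType) (x y : M) : << x >> * << y >> = << mmul x y >> :> {malg K[M]}.
Proof. by rewrite malgM_def fgmulUU mulr1. Qed.

Lemma malgC_mul (M : monomType) (c : K) (x : {malg K[M]}) :
  x * mkmalgU mone c = c *: x.
Proof.
rewrite malgM_def malgZ_def fgmulgU; apply/eq_bigr=> /= k _.
by rewrite mulm1 mulrC.
Qed.

Lemma malgAr (M : monomType) (c : K) (x y : {malg K[M]}) :
  x * (c *: y) = c *: (x * y).
Proof. by rewrite -mul_malgC mulrA malgC_mul scalerAl. Qed.

Lemma mulr_linear_l (M : monomType) (a : {malg K[M]}) : linear ( *%R a).
Proof. by move=> c x y; rewrite mulrDr malgAr. Qed.

Lemma starw_split u1 u2 v :
  starw (mmul u1 u2) v = sumL v (fun x y => starw u1 x * starw u2 y).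
Proof.
elim/word_ind: u1 v => [|n w IH] v.
  rewrite mul1m -[LHS](sumL_counitl v); apply: eq_sumL => x y.
  by rewrite starw1; case: eqP => _; [rewrite mul1r | rewrite mul0r].
rewrite -mulmA starwS.
under eq_sumL => x y do rewrite IH.
under [RHS]eq_sumL => x y do rewrite starwS.
pose G x y z := if wdeg x == n.+1 then << x >> * (starw w y * starw u2 z) else 0.
transitivity (sumL v (fun x y => sumL y (G x))).
  apply: eq_sumL => x y; rewrite /G; case: eqP => _; last by rewrite sumL0.
  exact: (sumL_linear _ _ (mulr_linear_l << x >>)).
rewrite -(sumLA v G); apply: eq_sumL => x y.
rewrite (sumL_linear _ _ (mulr_linear_r (starw u2 y))); apply: eq_sumL => a b.
by rewrite /G; case: eqP => _; [rewrite mulrA | rewrite mul0r].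
Qed.

Lemma homog0 n : homog n (0 : Sym K).
Proof. by move=> w; rewrite msupp0. Qed.

Lemma homogD n f g : homog n f -> homog n g -> homog n (f + g).
Proof.
move=> hf hg w /(fsubsetP (msuppD_le f g)); rewrite in_fsetU => /orP[/hf|/hg] //.
Qed.

Lemma homogU n w : wdeg w = n -> homog n (<< w >> : Sym K).
Proof. by move=> e x /(fsubsetP msuppU_le); rewrite in_fset1 => /eqP->. Qed.

Lemma homogM m n f g : homog m f -> homog n g -> homog (m + n) (f * g).
Proof.
move=> hf hg w /(fsubsetP (msuppM_incl _ _)) /imfset2P[x /= /hf <-] [y /= /hg <-] ->.
exact: wdegM.
Qed.

Lemma homog_sum n (I : eqType) (r : seq I) (F : I -> Sym K) :
  (forall i, i \in r -> homog n (F i)) -> homog n (\sum_(i <- r) F i).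
Proof.
move=> h; rewrite big_seq; elim/big_ind: _ => //; first exact: homog0.
by move=> *; apply: homogD.
Qed.

Lemma homog_sumL n v (F : word -> word -> Sym K) : (forall x y, (wdeg x + wdeg y = wdeg v)%N -> homog n (F x y)) ->
  homog n (sumL v F).
Proof.
move=> h.
rewrite (sumL_deg (G := fun x y => if (wdeg x + wdeg y == wdeg v)%N then F x y else 0)).
  by apply: homog_sum => p _; case: eqP => // [/h //|_]; apply: homog0.
by move=> x y ->; rewrite eqxx.
Qed.

Lemma starw_homog u v : homog (wdeg v) (starw u v).
Proof.
elim/word_ind: u v => [|n w IH] v.
  rewrite starw1; case: eqP => [->|_]; last exact: homog0.
  by rewrite wdeg1; apply: homogU; rewrite wdeg1.
rewrite starwS; apply: homog_sumL => x y <-; case: eqP => _; last exact: homog0.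
by apply: homogM => //; apply: homogU.
Qed.

Lemma starw_neq u v : wdeg u <> wdeg v -> starw u v = 0.
Proof.
elim/word_ind: u v => [|n w IH] v.
  by rewrite wdeg1 starw1; case: eqP => // ->; rewrite wdeg1.
rewrite wdegM wdegS starwS => ne; rewrite -[RHS](sumL0 _ v); apply: sumL_deg => x y d.
case: eqP => // e; rewrite IH ?mulr0 // => e2; apply: ne.
by rewrite -d e e2.
Qed.

Lemma starw_Sl n v : starw (Sw n) v = if wdeg v == n then << v >> else 0.
Proof.
rewrite -[Sw n]mulm1 starwS -(sumL_counitr v (fun x => if wdeg x == n then << x >> else 0 : Sym K)); apply: eq_sumL => x y.
rewrite starw1; case: ifP => _; last by case: eqP.
by case: eqP => _; [rewrite mulr1 | rewrite mulr0].
Qed.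

Lemma starw_Sr n u : starw u (Sw n) = if wdeg u == n then << u >> else 0.
Proof.
elim/word_ind: u n => [|m w IH] n.
  by rewrite starw1 -wdeg_eq0 wdeg1 wdegS eq_sym.
rewrite starwS -[Sw n]mulm1 sumLS.
under eq_bigr => a _ do rewrite sumL1 !mulm1 wdegS IH.
rewrite wdegM wdegS.
have [le|lt] := leqP m.+1 n.
  have lt : (m.+1 < n.+1)%N by [].
  rewrite (bigD1 (Ordinal lt)) //= eqxx big1 ?addr0 => [|i ne].
    rewrite -(eqn_add2l m.+1 (wdeg w)) subnKC //.
    by case: eqP => _; [rewrite UM | rewrite mulr0].
  by rewrite ifN //; apply: contra ne => /eqP e; apply/eqP/val_inj.
rewrite big1 => [|i _].
  by rewrite ifN // gtn_eqF // ltn_addr.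
by rewrite ifN // ltn_eqF // (leq_ltn_trans _ lt) // -ltnS.
Qed.

Definition st f g : Sym K := lin (fun u => lin (starw u) g) f.

Lemma stUU u v : st << u >> << v >> = starw u v.
Proof. by rewrite /st !linU. Qed.

Lemma st_linl g : linear (st^~ g). Proof. exact: lin_is_linear. Qed.
Lemma st_linr f : linear (st f).
Proof. by apply: lin_linear => b; apply: lin_is_linear. Qed.

Lemma linear_comp (U V W : lmodType K) (a : V -> W) (b : U -> V) :
  linear a -> linear b -> linear (fun s : U => a (b s)).
Proof. by move=> la lb c s t; rewrite lb la. Qed.

Lemma linear_sumL (U V : lmodType K) w (F : word -> word -> U -> V) :
  (forall x y, linear (F x y)) -> linear (fun z : U => sumL w (fun x y => F x y z)).
Proof.
move=> l c s t; rewrite /sumL scaler_sumr -big_split /=.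
by apply: eq_bigr => p _; rewrite l.
Qed.

Definition lin2 (V : lmodType K) (F : word -> word -> V) f g : V :=
  lin (fun x => lin (F x) g) f.

Lemma lin2_l V F g : linear (fun f => @lin2 V F f g).
Proof. exact: lin_is_linear. Qed.
Lemma lin2_r V F f : linear (@lin2 V F f).
Proof. by apply: lin_linear => b; apply: lin_is_linear. Qed.
Lemma lin2U V F x y : @lin2 V F << x >> << y >> = F x y.
Proof. by rewrite /lin2 !linU. Qed.

Lemma linear0' (U V : lmodType K) (a : U -> V) : linear a -> a 0 = 0.
Proof. by move=> l; move: (l (-1) 0 0); rewrite scaler0 addr0 scaleN1r addNr. Qed.

Lemma Delta_star (V : lmodType K) (F : word -> word -> V) v w :
  lin (fun z => sumL z F) (starw v w) =
  sumL v (fun v1 v2 => sumL w (fun w1 w2 => lin2 F (starw v1 w1) (starw v2 w2))).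
Proof.
elim/word_ind: v w F => [|m v IH] w F.
  rewrite sumL1 starw1.
  transitivity (if w == mone then F mone mone else 0).
    case: eqP => _; last by rewrite (linear0' (lin_is_linear _)).
    by rewrite -[1]/(<< mone >>) linU sumL1.
  rewrite -(sumL_counitl w (fun y => if y == mone then F mone mone else 0)).
  apply: eq_sumL => x y; rewrite !starw1.
  case: eqP => _; last by rewrite (linear0' (lin2_l _ _)).
  case: eqP => _; last by rewrite (linear0' (lin2_r _ _)).
  by rewrite -[1]/(<< mone >>) lin2U.
pose Fs x1 x2 a b := F (mmul x1 a) (mmul x2 b).
pose H x1 y1 x2 y2 : V := if (wdeg x1 + wdeg x2 == m.+1)%N then
  sumL v (fun v1 v2 => lin2 (Fs x1 x2) (starw v1 y1) (starw v2 y2)) else 0.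
rewrite starwS (sumL_linear _ _ (lin_is_linear _)).
transitivity (sumL w (fun x y => sumL x (fun x1 x2 => sumL y (fun y1 y2 =>
   H x1 y1 x2 y2)))).
  apply: eq_sumL => x y; case: eqP => [e|ne].
    transitivity (sumL x (fun x1 x2 => lin (fun z => sumL z (Fs x1 x2)) (starw v y))).
      move: (starw v y); apply: linear_ext.
      - exact: (linear_comp (lin_is_linear _) (mulr_linear_l _)).
      - by apply: linear_sumL => a b; apply: lin_is_linear.
      move=> b; rewrite UM linU sumLM; apply: eq_sumL => p q; by rewrite linU.
    apply: sumL_deg => x1 x2 d; rewrite IH /H d e eqxx sumL_swap.
    by [].
  rewrite (linear0' (lin_is_linear _)) -[LHS](sumL0 _ x); apply: sumL_deg => x1 x2 d.
  by rewrite -[LHS](sumL0 _ y); apply: eq_sumL => y1 y2; rewrite /H d; case: eqP.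
rewrite (sumL4 w (fun x1 x2 y1 y2 => H x1 y1 x2 y2)).
rewrite sumLS.
transitivity (\sum_(a < m.+2) sumL w (fun w1 w2 => sumL w1 (fun x1 y1 =>
  sumL w2 (fun x2 y2 => if (wdeg x1 == a) && (wdeg x2 == m.+1 - a)%N then
  sumL v (fun v1 v2 => lin2 (Fs x1 x2) (starw v1 y1) (starw v2 y2)) else 0)))).
  rewrite -sumL_sum; apply: eq_sumL => w1 w2.
  rewrite -sumL_sum; apply: eq_sumL => x1 y1.
  rewrite -sumL_sum; apply: eq_sumL => x2 y2.
  rewrite /H -big_mkcond; case: eqP => [e|ne].
    have lt : (wdeg x1 < m.+2)%N by rewrite ltnS -e leq_addr.
    rewrite (big_pred1 (Ordinal lt)) // => i /=.
    rewrite -(inj_eq val_inj) /= eq_sym.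
    by case: eqP => // ->; rewrite -e addKn eqxx.
  rewrite big1 // => i /andP[/eqP e1 /eqP e2]; case: ne.
  by rewrite e1 e2 subnKC // -ltnS.
apply: eq_bigr => a _; rewrite sumL_swap; apply: eq_sumL => w1 w2.
pose T x1 y1 x2 y2 v1 v2 : V := if (wdeg x1 == a) && (wdeg x2 == m.+1 - a)%N then
  lin2 (Fs x1 x2) (starw v1 y1) (starw v2 y2) else 0.
transitivity (sumL w1 (fun x1 y1 => sumL w2 (fun x2 y2 => sumL v (T x1 y1 x2 y2)))).
  apply: eq_sumL => x1 y1; apply: eq_sumL => x2 y2; rewrite /T.
  by case: ifP => //; rewrite sumL0.
under eq_sumL => x1 y1 do rewrite sumL_swap.
rewrite sumL_swap; apply: eq_sumL => v1 v2.
rewrite !starwS (sumL_linear _ _ (lin2_l _ _)); apply: eq_sumL => x1 y1.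
rewrite (sumL_linear _ _ (lin2_r _ _)); apply: eq_sumL => x2 y2.
rewrite /T; case: eqP => _; last by rewrite (linear0' (lin2_l _ _)).
case: eqP => _ /=; last by rewrite (linear0' (lin2_r _ _)).
move: (starw v1 y1) (starw v2 y2) => f g.
move: f; apply: linear_ext; first exact: lin2_l.
  exact: (linear_comp (lin2_l _ _) (mulr_linear_l _)).
move=> p; move: g; apply: linear_ext; first exact: lin2_r.
  exact: (linear_comp (lin2_r _ _) (mulr_linear_l _)).
by move=> q; rewrite !UM !lin2U.
Qed.

Lemma st_split f1 f2 v :
  st (f1 * f2) << v >> = sumL v (fun x y => st f1 << x >> * st f2 << y >>).
Proof.
move: f1; apply: linear_ext => [||u1].
- exact: (linear_comp (st_linl _) (mulr_linear_r _)).
- apply: linear_sumL => x y.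
  exact: (linear_comp (mulr_linear_r _) (st_linl _)).
move: f2; apply: linear_ext => [||u2].
- exact: (linear_comp (st_linl _) (mulr_linear_l _)).
- apply: linear_sumL => x y.
  exact: (linear_comp (mulr_linear_l _) (st_linl _)).
rewrite UM stUU starw_split; apply: eq_sumL => x y; by rewrite !stUU.
Qed.

Lemma st1 g : st << mone >> g = lin (fun v => if v == mone then 1 else 0) g.
Proof. by rewrite /st linU; apply: eq_lin => v; rewrite starw1. Qed.

Lemma st_assocU u v w : st (starw u v) << w >> = st << u >> (starw v w).
Proof.
elim/word_ind: u v w => [|m u IH] v w.
  rewrite starw1 st1.
  transitivity (if (v == mone) && (w == mone) then 1 else 0 : Sym K).
    case: eqP => _ /=; last exact: (linear0' (st_linl _)).
    by rewrite stUU starw1.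
  have [->|ne] := eqVneq v mone.
    rewrite starw1; case: eqP => _; first by rewrite linU eqxx.
    by rewrite (linear0' (lin_is_linear _)).
  rewrite /= /lin big_seq big1 // => z zs.
  case: eqP => [e|_]; last by rewrite scaler0.
  move: (starw_homog zs); rewrite e wdeg1 => d0.
  have: wdeg v <> wdeg w by rewrite -d0; apply/eqP; rewrite wdeg_eq0.
  by move/starw_neq => e0; rewrite e0 msupp0 in zs.
pose F x y : Sym K := if wdeg x == m.+1 then << x >> * starw u y else 0.
transitivity (lin (fun z => sumL z F) (starw v w)); last first.
  by rewrite /st linU; apply: eq_lin => z; rewrite starwS.
rewrite Delta_star starwS (sumL_linear _ _ (st_linl _)).
apply: eq_sumL => v1 v2; case: eqP => [e|ne].
  rewrite st_split; apply: eq_sumL => w1 w2.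
  rewrite IH.
  transitivity (starw v1 w1 * st << u >> (starw v2 w2)); first by rewrite stUU.
  transitivity (lin2 (fun x y => << x >> * starw u y) (starw v1 w1) (starw v2 w2)).
    move: (starw v1 w1) (starw v2 w2) => f g.
    move: f; apply: linear_ext; first exact: mulr_linear_r.
      exact: lin2_l.
    move=> p; move: g; apply: linear_ext; last by move=> q; rewrite lin2U stUU.
      exact: (linear_comp (mulr_linear_l _) (st_linr _)).
    exact: lin2_r.
  have [e1|/eqP n1] := eqVneq (wdeg v1) (wdeg w1); last first.
    by rewrite (starw_neq n1) !(linear0' (lin2_l _ _)).
  rewrite /lin2 /lin; apply: eq_big_seq => x xs; apply: (congr1 ( *:%R _)).
  apply: eq_bigr => y _; rewrite /F.
  by rewrite (starw_homog xs) -e1 e eqxx.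
rewrite (linear0' (st_linl _)) -[LHS](sumL0 _ w); apply: eq_sumL => w1 w2.
have [e1|/eqP n1] := eqVneq (wdeg v1) (wdeg w1); last first.
  by rewrite (starw_neq n1) (linear0' (lin2_l _ _)).
rewrite /lin2 /lin big_seq big1 // => x xs.
rewrite big1 ?scaler0 // => y _; rewrite /F (starw_homog xs) -e1.
by case: eqP => //; rewrite scaler0.
Qed.

Lemma st_assoc : associative st.
Proof.
move=> f g h.
move: f; apply: linear_ext => [||u]; first exact: st_linl.
  exact: (linear_comp (st_linl _) (st_linl _)).
move: g; apply: linear_ext => [||v].
- exact: (linear_comp (st_linr _) (st_linl _)).
- exact: (linear_comp (st_linl _) (st_linr _)).
move: h; apply: linear_ext => [||w].
- exact: (linear_comp (st_linr _) (st_linr _)).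
- exact: st_linr.
by rewrite [st << v >> _]stUU [st << u >> << v >>]stUU st_assocU.
Qed.

Lemma tcons_l k (T : TSym K k) : linear (fun f => tcons f T).
Proof. exact: lin_is_linear. Qed.
Lemma tcons_r k f : linear (@tcons K k f).
Proof. by apply: lin_linear => b; apply: lin_is_linear. Qed.
Lemma tstar_l k s (U : TSym K k) : linear (fun T => tstar s T U).
Proof. exact: lin_is_linear. Qed.
Lemma tstar_r k s (T : TSym K k) : linear (tstar s T).
Proof. by apply: lin_linear => b; apply: lin_is_linear. Qed.
Lemma mu_linear k : linear (@mu K k).
Proof. exact: lin_is_linear. Qed.

Lemma tconsUU k u (t : k.-tuple word) :
  tcons << u >> << t >> = << [tuple of u :: t] >> :> TSym K k.+1.
Proof. by rewrite /tcons !linU. Qed.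

Lemma mu_tcons k f (T : TSym K k) : mu (tcons f T) = f * mu T.
Proof.
move: f; apply: linear_ext => [||u].
- exact: (linear_comp (@mu_linear _) (@tcons_l _ _)).
- exact: mulr_linear_r.
move: T; apply: linear_ext => [||t].
- exact: (linear_comp (@mu_linear _) (@tcons_r _ _)).
- exact: (linear_comp (mulr_linear_l _) (@mu_linear _)).
by rewrite tconsUU /mu !linU big_cons.
Qed.

Lemma tstar_tcons k f g (T U : TSym K k) :
  tstar st (tcons f T) (tcons g U) = tcons (st f g) (tstar st T U).
Proof.
move: f; apply: linear_ext => [||u].
- exact: (linear_comp (@tstar_l _ _ _) (@tcons_l _ _)).
- exact: (linear_comp (@tcons_l _ _) (@st_linl _)).
move: g; apply: linear_ext => [||v].
- exact: (linear_comp (@tstar_r _ _ _) (@tcons_l _ _)).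
- exact: (linear_comp (@tcons_l _ _) (@st_linr _)).
move: T; apply: linear_ext => [||t].
- exact: (linear_comp (@tstar_l _ _ _) (@tcons_r _ _)).
- exact: (linear_comp (@tcons_r _ _) (@tstar_l _ _ _)).
move: U; apply: linear_ext => [||s].
- exact: (linear_comp (@tstar_r _ _ _) (@tcons_r _ _)).
- exact: (linear_comp (@tcons_r _ _) (@tstar_r _ _ _)).
rewrite !tconsUU /tstar !linU /=; congr tcons.
  by rewrite /thead tnth_mktuple !(tnth_nth mone).
congr tensor; apply: eq_from_tnth => i; rewrite tnth_behead !tnth_mktuple.
by congr (st << _ >> << _ >>); rewrite !(tnth_nth mone) /= inordK // ltnS.
Qed.

Lemma DeltaU w : Delta << w >> = sumL w (fun x y => << (x, y) >>) :> Sym2 K.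
Proof.
rewrite /Delta /alg_ext linU.
elim/word_ind: w => [|n w IH].
  by rewrite fm1 big_nil sumL1.
rewrite fmM fmU big_cons IH sumLS mulr_suml; apply: eq_bigr => a _.
rewrite (sumL_linear _ _ (mulr_linear_l _)); apply: eq_sumL => x y.
by rewrite !SE /tensor2 !linU UM.
Qed.

Lemma DeltakSU k w :
  Deltak k.+1 << w >> = sumL w (fun x y => tcons << x >> (Deltak k << y >>)) :> TSym K k.+1.
Proof.
rewrite [LHS]/= DeltaU (sumL_linear _ _ (lin_is_linear _)).
by apply: eq_sumL => x y; rewrite linU.
Qed.

Lemma Deltak_linear k : linear (@Deltak K k).
Proof.
case: k => [|k] a f g /=.
  by rewrite mcoeffD mcoeffZ scalerDl scalerA.
by rewrite /Delta /alg_ext linearP linearP.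
Qed.

Lemma st_splitting k (s : k.-tuple (Sym K)) g :
  st (\prod_(i < k) tnth s i) g = mu (tstar st (tensor s) (Deltak k g)).
Proof.
move: g; apply: linear_ext => [||w]; first exact: st_linr.
  exact: (linear_comp (@mu_linear _) (linear_comp (@tstar_r _ _ _) (@Deltak_linear _))).
elim: k s w => [|k IH] s w.
  rewrite big_ord0 /= /tstar linU -[1]/(<< mone >>) st1 linU.
  rewrite mcoeffU1 eq_sym; case: eqP => _.
    by rewrite scale1r linU /mu linU big_nil.
  by rewrite scale0r (linear0' (lin_is_linear _)) (linear0' (@mu_linear _)).
rewrite DeltakSU (sumL_linear _ _ (@tstar_r _ _ _)) (sumL_linear _ _ (@mu_linear _)).
rewrite big_ord_recl st_split; apply: eq_sumL => x y.
rewrite [tensor s]/= tstar_tcons mu_tcons -IH; congr (st _ _ * st _ _).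
by apply: eq_bigr => i _; rewrite tnth_behead; congr tnth; apply/val_inj;
  rewrite /= inordK // ltnS.
Qed.

Lemma lin_homog n f (V : lmodType K) (h1 h2 : word -> V) : homog n f ->
  (forall w, wdeg w = n -> h1 w = h2 w) -> lin h1 f = lin h2 f.
Proof. by move=> hf e; apply: eq_big_seq => w /hf /e ->. Qed.

Lemma lin0 f (V : lmodType K) : lin (fun=> 0 : V) f = 0.
Proof. by rewrite /lin big1 // => *; rewrite scaler0. Qed.

Lemma internal_product_exists : exists star, is_internal_product (K := K) star.
Proof.
exists st; split.
- exact: st_linl.
- exact: st_linr.
- exact: st_assoc.
- move=> m n f g hf hg ne; rewrite -[RHS](lin0 f); apply: (lin_homog hf) => u eu.
  rewrite -[RHS](lin0 g); apply: (lin_homog hg) => v ev.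
  by apply: starw_neq; rewrite eu ev.
- move=> n g hg; rewrite SE /st linU [RHS](lin_id idfun g).
  by apply: (lin_homog hg) => v ev; rewrite starw_Sl ev eqxx.
- move=> n f hf; rewrite SE /st [RHS](lin_id idfun f).
  by apply: (lin_homog hf) => u eu; rewrite linU starw_Sr eu eqxx.
exact: st_splitting.
Qed.

Lemma star_letter star n v : is_internal_product star ->
  star << Sw n >> << v >> = (if wdeg v == n then << v >> else 0) :> Sym K.
Proof.
move=> sP; rewrite -SE; case: eqP => [e|ne].
  by apply: (star_S_left sP); apply: homogU.
apply: (@star_neq_deg _ _ sP n (wdeg v)); last by move=> e; apply: ne.
  by rewrite SE; apply: homogU; apply: wdegS.
exact: homogU.
Qed.

Lemma tensor_letters k (s : k.-tuple (Sym K)) :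
  (forall i, exists n, tnth s i = Sf K n) ->
  exists2 t : k.-tuple word, tensor s = << t >>
    & forall i, exists n, tnth t i = Sw n.
Proof.
elim: k s => [|k IH] s h; first by exists [tuple] => // -[].
have [|t et ht] := IH [tuple of behead s].
  by move=> i; rewrite tnth_behead; apply: h.
have [n en] := h ord0.
exists [tuple of Sw n :: t]; first by rewrite /= et /thead en SE tconsUU.
move=> i; case: (unliftP ord0 i) => [j ->|->]; last by exists n.
by rewrite tnthS; apply: ht.
Qed.

Lemma internal_product_unique (star1 star2 : Sym K -> Sym K -> Sym K) :
  is_internal_product star1 -> is_internal_product star2 ->
  forall f g, star1 f g = star2 f g.
Proof.
move=> P1 P2 f g.
move: f; apply: linear_ext; [exact: star_linearl|exact: star_linearl|move=> u].
have -> : << u >> = \prod_(i < size u) tnth [tuple Sf K (tnth (in_tuple u) j).+1 | j < size u] i.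
  under eq_bigr => i _ do rewrite tnth_mktuple.
  rewrite -(big_tuple _ _ _ xpredT (fun n => Sf K n.+1)) /=.
  elim/word_ind: u => [|n w IH]; first by rewrite fm1 big_nil.
  by rewrite -[in LHS]UM fmM fmU big_cons -IH -[<< Sw n.+1 >>]SE.
apply: etrans (star_splitting P1 _ _) (esym (etrans (star_splitting P2 _ _) _)).
apply: (congr1 (@mu K _)).
have [|t et ht] := @tensor_letters _ [tuple Sf K (tnth (in_tuple u) j).+1 | j < size u].
  by move=> i; exists (tnth (in_tuple u) i).+1; rewrite tnth_mktuple.
rewrite et; apply: etrans (linU _ _) (esym (etrans (linU _ _) _)).
apply: eq_lin => w; apply: (congr1 (@tensor K _)).
apply: eq_from_tnth => i; rewrite !tnth_mktuple.
by have [n ->] := ht i; rewrite (star_letter _ _ P1) (star_letter _ _ P2).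
Qed.

End InternalProduct.

(* Main.v *)
(* Let S(t) = sum_n S_n t^n and T(t) = S(qt)^-1 S(t) = sum_n S_n((1-q)A) t^n.
   The image of theta_q is the algebra generated by the T_n, and T(t) is
   grouplike, so that this algebra and P are stable under the coproduct.  By the
   splitting formula, (S_m T_i1 .. T_ik) * g is a sum of products
   (S_m * g_0) (T_i1 * g_1) .. (T_ik * g_k) with all g_j in P; here S_m * g_0 is
   the component of g_0 of degree m, so it is enough that T_i * g lies in the
   image of theta_q for g in P.  Since S(qt)^-1 * _ is the antipode twisted by
   q^deg, (sum_n T_n) * (S_n h) = sum q^|h_1| antipode(h_1) T_n h_2, and the
   antipode preserves the image of theta_q.

   For the dimensions: T_n = (1 - q^n) S_n + (longer words), and
   T(q^(r-1) t) .. T(q t) T(t) = 1 expresses T_n, for r | n, by the T_m with m < n.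
   So P is spanned by the S_i1 T_i2 .. T_ik with i2, .., ik not divisible by r,
   which are independent because their leading words S^(i1, .., ik) are distinct. *)

Require Import Defs.
From mathcomp Require Import all_boot all_order all_algebra.
From mathcomp Require Import boolp finmap.

Set Implicit Arguments.
Unset Strict Implicit.
Unset Printing Implicit Defensive.

Import GRing.Theory.
Local Open Scope ring_scope.

(** * Linear spans *)

Lemma linear_big (K : fieldType) (U V : lmodType K) (phi : U -> V)
    (I : Type) (s : seq I) (Q : pred I) F :
  linear phi -> phi (\sum_(i <- s | Q i) F i) = \sum_(i <- s | Q i) phi (F i).
Proof.
move=> l; elim/big_rec2: _ => [|i x y _ <-]; first exact: linear0' l.
by rewrite -[F i in LHS]scale1r l scale1r.
Qed.

Section LinearSpan.
Variable K : fieldType.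

(** An inductive predicate, so that claims about linear combinations are proved by adding one term
    at a time, without index families. *)
Inductive lspan (V : lmodType K) (G : V -> Prop) : V -> Prop :=
| lspan0 : lspan G 0
| lspan_cons a x f : G x -> lspan G f -> lspan G (a *: x + f).

Section Closure.
Variables (V : lmodType K) (G : V -> Prop).

Lemma lspanP a f g : lspan G f -> lspan G g -> lspan G (a *: f + g).
Proof.
move=> hf hg; elim: hf => [|b x f' Gx _ IH]; first by rewrite scaler0 add0r.
by rewrite scalerDr scalerA -addrA; apply: lspan_cons.
Qed.

Lemma lspanZ a f : lspan G f -> lspan G (a *: f).
Proof. by move=> hf; rewrite -[X in lspan G X]addr0; apply/lspanP/lspan0. Qed.

Lemma lspanD f g : lspan G f -> lspan G g -> lspan G (f + g).
Proof. by rewrite -{2}[f]scale1r; apply: lspanP. Qed.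

Lemma lspanN f : lspan G f -> lspan G (- f).
Proof. by rewrite -[X in _ -> lspan G X]scaleN1r; apply: lspanZ. Qed.

Lemma lspanB f g : lspan G f -> lspan G g -> lspan G (f - g).
Proof. by move=> hf hg; apply: lspanD => //; apply: lspanN. Qed.

Lemma lspan_sum (I : Type) (s : seq I) (Q : pred I) F :
  (forall i, Q i -> lspan G (F i)) -> lspan G (\sum_(i <- s | Q i) F i).
Proof. by move=> h; elim/big_ind: _ => //; [apply: lspan0 | apply: lspanD]. Qed.

Lemma lspan_gen x : G x -> lspan G x.
Proof. by move=> Gx; rewrite -[x]addr0 -{1}[x]scale1r; apply: lspan_cons Gx (lspan0 G). Qed.

End Closure.

Lemma lspan_linear (U V : lmodType K) (G : U -> Prop) (H : V -> Prop) phi f :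
  linear phi -> (forall x, G x -> lspan H (phi x)) -> lspan G f -> lspan H (phi f).
Proof.
move=> l h; elim=> [|a x g Gx _ IH]; first by rewrite (linear0' l); apply: lspan0.
by rewrite l; apply: lspanP => //; apply: h.
Qed.

Lemma lspan_sub (V : lmodType K) (G H : V -> Prop) f :
  (forall x, G x -> lspan H x) -> lspan G f -> lspan H f.
Proof. by move=> h; apply: (@lspan_linear _ _ _ _ id). Qed.

Lemma lspan_bilinear (U V W : lmodType K) (G : U -> Prop) (H : V -> Prop)
    (I : W -> Prop) (phi : U -> V -> W) f g :
  (forall y, linear (phi^~ y)) -> (forall x, linear (phi x)) ->
  (forall x y, G x -> H y -> lspan I (phi x y)) ->
  lspan G f -> lspan H g -> lspan I (phi f g).
Proof.
move=> l1 l2 h hf hg; apply: (lspan_linear (l1 g)) hf => x Gx.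
by apply: (lspan_linear (l2 x)) hg => y; apply: h.
Qed.

Lemma lspan_malg (B : choiceType) (V : lmodType K) (G : V -> Prop)
    (phi : {malg K[B]} -> V) f :
  linear phi -> (forall b, lspan G (phi << b >>)) -> lspan G (phi f).
Proof.
move=> l h.
have ->: phi f = lin (fun b => phi << b >>) f.
  by apply: linear_ext => // [|b]; [apply: lin_is_linear | rewrite linU].
by apply: lspan_sum => b _; apply/lspanZ/h.
Qed.

Lemma lspan_seq (T : eqType) (V : lmodType K) (b : T -> V) (s : seq T) f :
  uniq s -> lspan (fun x => exists2 w, w \in s & x = b w) f ->
  exists c : T -> K, f = \sum_(w <- s) c w *: b w.
Proof.
move=> us; elim=> [|a _ g [w ws ->] _ [c ->]].
  by exists (fun=> 0); rewrite big1 // => w _; rewrite scale0r.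
exists (fun v => (if v == w then a else 0) + c v).
under [RHS]eq_bigr => v _ do rewrite scalerDl.
rewrite big_split /=; congr (_ + _).
rewrite (bigD1_seq w) //= eqxx big1 ?addr0 // => v /negPf->.
by rewrite scale0r.
Qed.

End LinearSpan.

(** * Algebra morphisms out of [Sym] *)

Section MonoidAlgebra.
Variables (K : fieldType) (M : monomType).
Local Notation A := {malg K[M]}.

Section AlgExt.
Variable v : nat -> A.

Lemma alg_ext_linear : linear (alg_ext v).
Proof. exact: lin_is_linear. Qed.

Lemma alg_ext1 : alg_ext v 1 = 1.
Proof. by rewrite -[1]/(<< mone >>) /alg_ext linU fm1 big_nil. Qed.

Lemma alg_extM f g : alg_ext v (f * g) = alg_ext v f * alg_ext v g.
Proof.
move: f; apply: linear_ext => [||u].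
- exact: (linear_comp alg_ext_linear (mulr_linear_r _)).
- exact: (linear_comp (mulr_linear_r _) alg_ext_linear).
move: g; apply: linear_ext => [||w].
- exact: (linear_comp alg_ext_linear (mulr_linear_l _)).
- exact: (linear_comp (mulr_linear_l _) alg_ext_linear).
by rewrite UM /alg_ext !linU fmM big_cat.
Qed.

Lemma alg_extS n : v 0 = 1 -> alg_ext v (Sf K n) = v n.
Proof.
move=> v0; case: n => [|n]; first by rewrite alg_ext1.
by rewrite /alg_ext linU fmU big_seq1.
Qed.

End AlgExt.

End MonoidAlgebra.

(** * The tensor square *)

Section Tensor.
Variable K : fieldType.
Implicit Types f g : Sym K.

Lemma tensor2_l g : linear (fun f => tensor2 f g).
Proof. exact: lin2_l. Qed.
Lemma tensor2_r f : linear (tensor2 f).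
Proof. exact: lin2_r. Qed.
Lemma tensor2U u v : tensor2 << u >> << v >> = << (u, v) >> :> Sym2 K.
Proof. exact: lin2U. Qed.

Lemma tensor2M f1 g1 f2 g2 :
  tensor2 f1 g1 * tensor2 f2 g2 = tensor2 (f1 * f2) (g1 * g2).
Proof.
move: f1; apply: linear_ext => [||u1].
- exact: (linear_comp (mulr_linear_r _) (tensor2_l _)).
- exact: (linear_comp (tensor2_l _) (mulr_linear_r _)).
move: g1; apply: linear_ext => [||v1].
- exact: (linear_comp (mulr_linear_r _) (tensor2_r _)).
- exact: (linear_comp (tensor2_r _) (mulr_linear_r _)).
move: f2; apply: linear_ext => [||u2].
- exact: (linear_comp (mulr_linear_l _) (tensor2_l _)).
- exact: (linear_comp (tensor2_l _) (mulr_linear_l _)).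
move: g2; apply: linear_ext => [||v2].
- exact: (linear_comp (mulr_linear_l _) (tensor2_r _)).
- exact: (linear_comp (tensor2_r _) (mulr_linear_l _)).
by rewrite !tensor2U !UM tensor2U.
Qed.

Lemma tensor2_1r f g : tensor2 f 1 * tensor2 1 g = tensor2 f g.
Proof. by rewrite tensor2M; congr tensor2; [rewrite mulr1 | rewrite mul1r]. Qed.
Lemma tensor2_1l f g : tensor2 1 g * tensor2 f 1 = tensor2 f g.
Proof. by rewrite tensor2M; congr tensor2; [rewrite mul1r | rewrite mulr1]. Qed.

Lemma tensor2_11 : tensor2 1 1 = 1 :> Sym2 K.
Proof. by rewrite -[1 : Sym K]/(<< mone >>) tensor2U. Qed.

Definition tens (P Q : Sym K -> Prop) : Sym2 K -> Prop :=
  lspan (fun z => exists f g, [/\ P f, Q g & z = tensor2 f g]).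

(* The linear map f (x) g |-> F f g on the tensor square. *)
Definition on2 (V : lmodType K) (F : word -> word -> V) : Sym2 K -> V :=
  lin (fun p => F p.1 p.2).

Lemma on2_linear V F : linear (@on2 V F).
Proof. exact: lin_is_linear. Qed.

Lemma on2_tensor V F f g : @on2 V F (tensor2 f g) = lin2 F f g.
Proof.
move: f; apply: linear_ext => [||u].
- exact: (linear_comp (on2_linear _) (tensor2_l _)).
- exact: lin2_l.
move: g; apply: linear_ext => [||v].
- exact: (linear_comp (on2_linear _) (tensor2_r _)).
- exact: lin2_r.
by rewrite tensor2U lin2U /on2 linU.
Qed.

Lemma on2_DeltaU V F w : @on2 V F (Delta << w >>) = sumL w F.
Proof.
rewrite DeltaU (sumL_linear _ _ (on2_linear F)); apply: eq_sumL => x y.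
by rewrite /on2 linU.
Qed.

Lemma Delta_linear : linear (@Delta K).
Proof. exact: alg_ext_linear. Qed.

Section Bilinear.
Variables (V : lmodType K) (phi : Sym K -> Sym K -> V).
Hypotheses (phil : forall h, linear (phi^~ h)) (phir : forall h, linear (phi h)).

Lemma on2_bilinear f g :
  on2 (fun u v => phi << u >> << v >>) (tensor2 f g) = phi f g.
Proof.
rewrite on2_tensor.
move: f; apply: linear_ext => [||u]; [exact: lin2_l|exact: phil|].
by move: g; apply: linear_ext => [||v]; [exact: lin2_r|exact: phir|rewrite lin2U].
Qed.

(** Handles Sweedler sums: once [Delta h] lies in [tens P Q], a sum of [phi h_1 h_2] may be treated
    as if h_1 were in [P] and h_2 in [Q]. *)
Lemma lspan_on2 (P Q : Sym K -> Prop) (G : V -> Prop) z :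
  (forall f g, P f -> Q g -> lspan G (phi f g)) ->
  tens P Q z -> lspan G (on2 (fun u v => phi << u >> << v >>) z).
Proof.
move=> h; apply: (lspan_linear (on2_linear _)) => _ [f [g [Pf Qg ->]]].
by rewrite on2_bilinear; apply: h.
Qed.

End Bilinear.

Lemma tensM (P1 P2 P3 Q1 Q2 Q3 : Sym K -> Prop) y z :
  (forall f g, P1 f -> P2 g -> P3 (f * g)) ->
  (forall f g, Q1 f -> Q2 g -> Q3 (f * g)) ->
  tens P1 Q1 y -> tens P2 Q2 z -> tens P3 Q3 (y * z).
Proof.
move=> hP hQ; apply: lspan_bilinear => [h|h|_ _ [f1 [g1 [? ? ->]]] [f2 [g2 [? ? ->]]]].
- exact: mulr_linear_r.
- exact: mulr_linear_l.
apply: lspan_gen; exists (f1 * f2), (g1 * g2); split; [exact: hP|exact: hQ|].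
exact: tensor2M.
Qed.

End Tensor.

(** * Noncommutative power series *)

Section Series.
Variables (K : fieldType) (M : monomType).
Local Notation A := {malg K[M]}.
Implicit Types (a b c : nat -> A) (s t : K).

(** A sequence [a] encodes the power series with coefficients [a n] in a central variable. *)
Definition cauchy a b (n : nat) : A := \sum_(i < n.+1) a i * b (n - i)%N.

Definition series1 (n : nat) : A := (n == 0)%:R.

(* a(t) |-> a(st) *)
Definition dil s a (n : nat) : A := s ^+ n *: a n.

Lemma cauchy0 a b : cauchy a b 0 = a 0 * b 0.
Proof. by rewrite /cauchy big_ord1. Qed.

Lemma cauchy_ends a b n : a 0 = 1 -> b 0 = 1 ->
  cauchy a b n.+1 = b n.+1 + \sum_(i < n) a i.+1 * b (n - i)%N + a n.+1.
Proof.
by move=> a0 b0; rewrite /cauchy big_ord_recr big_ord_recl /= subnn a0 b0 mul1r mulr1.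
Qed.

Lemma cauchyA a b c : cauchy a (cauchy b c) = cauchy (cauchy a b) c.
Proof.
apply: funext => n; rewrite /cauchy.
under eq_bigr => i _ do rewrite mulr_sumr.
under [RHS]eq_bigr => i _ do rewrite mulr_suml.
rewrite (sum_coassoc n (fun i j k => a i * b j * c k)).
by apply: eq_bigr => i _; apply: eq_bigr => j _; rewrite mulrA.
Qed.

Lemma cauchy1s a : cauchy series1 a = a.
Proof.
apply: funext => n; rewrite /cauchy big_ord_recl mul1r subn0 big1 ?addr0 // => i _.
by rewrite mul0r.
Qed.

Lemma cauchys1 a : cauchy a series1 = a.
Proof.
apply: funext => n; rewrite /cauchy big_ord_recr /= subnn mulr1 big1 ?add0r // => i _.
by rewrite /series1 subn_eq0 leqNgt ltn_ord mulr0.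
Qed.

Lemma dil_cauchy s a b : dil s (cauchy a b) = cauchy (dil s a) (dil s b).
Proof.
apply: funext => n; rewrite /dil /cauchy scaler_sumr; apply: eq_bigr => i _.
by rewrite malgAr -scalerAl scalerA -exprD subnK // -ltnS.
Qed.

Lemma dil_dil s t a : dil s (dil t a) = dil (s * t) a.
Proof. by apply: funext => n; rewrite /dil scalerA exprMn. Qed.

Lemma dil_1 a : dil 1 a = a.
Proof. by apply: funext => n; rewrite /dil expr1n scale1r. Qed.

Lemma dil_series1 s : dil s series1 = series1.
Proof.
by apply: funext => -[|n]; rewrite /dil ?expr0 ?scale1r // /series1 scaler0.
Qed.

Lemma dil0 s a : dil s a 0 = a 0.
Proof. by rewrite /dil expr0 scale1r. Qed.

(** As [a 0 = 1], the n-th coefficient of a product is the n-th term of the right factor plus terms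
    in its earlier coefficients. *)
Lemma cauchyI a b c : a 0 = 1 -> cauchy a b = cauchy a c -> b = c.
Proof.
move=> a0 e; apply: funext => n; elim/ltn_ind: n => n IH.
move: (congr1 (@^~ n) e); rewrite /cauchy !big_ord_recl a0 !mul1r subn0.
rewrite (eq_bigr (fun i : 'I_n => a (lift ord0 i) * c (n - (lift ord0 i))%N)).
  exact: addIr.
by move=> i _; rewrite IH // lift0 ltn_subrL (leq_ltn_trans _ (ltn_ord i)).
Qed.

Lemma cauchy_inverse a b : a 0 = 1 -> cauchy a b = series1 -> cauchy b a = series1.
Proof.
by move=> a0 e; apply: (cauchyI a0); rewrite cauchyA e cauchy1s cauchys1.
Qed.

Lemma cauchyC a b : (forall i j, a i * b j = b j * a i) -> cauchy a b = cauchy b a.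
Proof.
move=> ab; apply: funext => n; rewrite /cauchy (reindex_inj rev_ord_inj) /=.
by apply: eq_bigr => i _; rewrite ab subSS subKn // -ltnS.
Qed.

End Series.
Arguments series1 {K M}.

Lemma dil_cauchy_morph (K : fieldType) (M N : monomType)
    (phi : {malg K[M]} -> {malg K[N]}) (q : K) (a b c : nat -> {malg K[M]}) :
  linear phi -> {morph phi : x y / x * y} ->
  cauchy (dil q a) b = c -> cauchy (dil q (phi \o a)) (phi \o b) = phi \o c.
Proof.
move=> l m <-; apply: funext => n; rewrite /cauchy /dil /=.
rewrite (linear_big _ _ _ l); apply: eq_bigr => i _; rewrite m; congr (_ * _).
by rewrite -[_ *: a i]addr0 l (linear0' l) addr0.
Qed.

(** With z as variable, s(qz) u(z) v(z) = a(qz) u(z) b(qz) v(z) = a(z) b(z) = s(z) = s(qz) t(z), and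
    s(qz) cancels. *)
Lemma cauchy_quotientM (K : fieldType) (M : monomType) (q : K)
    (a b s t u v : nat -> {malg K[M]}) :
  s 0 = 1 -> s = cauchy a b -> (forall i j, b i * u j = u j * b i) ->
  cauchy (dil q a) u = a -> cauchy (dil q b) v = b -> cauchy (dil q s) t = s ->
  t = cauchy u v.
Proof.
move=> s0 es bu eu ev et.
apply: (cauchyI (a := dil q s)); first by rewrite /dil expr0 scale1r.
rewrite et es dil_cauchy -cauchyA [X in _ = cauchy _ X]cauchyA.
rewrite (cauchyC (a := dil q b) (b := u)); last first.
  by move=> i j; rewrite /dil malgAr -scalerAl bu.
by rewrite -cauchyA cauchyA eu ev.
Qed.

(** * The series S(t), its inverse, and T(t) *)

Section SymSeries.
Variables (K : fieldType) (q : K).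
Local Notation Sg := (Sf K).

(** With the sign absorbed, these are the coefficients of S(t)^-1. *)
Definition lam (n : nat) : Sym K := (-1) ^+ n *: Lambda K n.

(* T n = S_n((1-q)A) *)
Definition T : nat -> Sym K := cauchy (dil q lam) Sg.

Lemma lam_S : cauchy lam Sg = series1.
Proof.
apply: funext => -[|n]; first by rewrite cauchy0 mulr1 /lam expr0 scale1r.
rewrite /series1 -[RHS](@Lambda_rel K n.+1) //; apply: eq_bigr => i _.
by rewrite -scalerAl.
Qed.

Lemma lam0 : lam 0 = 1.
Proof. by rewrite /lam expr0 scale1r. Qed.

Lemma S_lam : cauchy Sg lam = series1.
Proof. exact: cauchy_inverse lam0 lam_S. Qed.

Lemma T0 : T 0 = 1.
Proof. by rewrite /T cauchy0 /dil expr0 scale1r lam0 mulr1. Qed.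

(** Since S(qt) is cancellable, this determines T(t); its coproduct, recursion and telescoping
    products all come from here. *)
Lemma dilS_T : cauchy (dil q Sg) T = Sg.
Proof. by rewrite /T cauchyA -dil_cauchy S_lam dil_series1 cauchy1s. Qed.

Lemma theta_linear : linear (theta q).
Proof. exact: alg_ext_linear. Qed.

Lemma thetaM : {morph theta q : f g / f * g}.
Proof. exact: alg_extM. Qed.

Lemma theta1 : theta q 1 = 1.
Proof. exact: alg_ext1. Qed.

Lemma theta_S n : theta q (Sg n) = T n.
Proof.
have e m : \sum_(i < m.+1) (- q) ^+ i *: (Lambda K i * Sg (m - i)) = T m.
  by apply: eq_bigr => i _; rewrite /dil /lam scalerA -scalerAl -exprMn mulrN1.
by rewrite -e; apply: alg_extS; rewrite e T0.
Qed.

Lemma DeltaM : {morph @Delta K : f g / f * g}.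
Proof. exact: alg_extM. Qed.

Lemma Delta1 : @Delta K 1 = 1.
Proof. exact: alg_ext1. Qed.

(** The two copies of [Sym] in the tensor square commute, and a grouplike series is the product of
    its two copies, as [cauchy_quotientM] requires. *)
Let emb1 (f : Sym K) : Sym2 K := tensor2 f 1.
Let emb2 (f : Sym K) : Sym2 K := tensor2 1 f.

Let emb1_linear : linear emb1. Proof. exact: tensor2_l. Qed.
Let emb2_linear : linear emb2. Proof. exact: tensor2_r. Qed.
Let emb1M : {morph emb1 : f g / f * g}.
Proof. by move=> f g; rewrite /emb1 tensor2M mulr1. Qed.
Let emb2M : {morph emb2 : f g / f * g}.
Proof. by move=> f g; rewrite /emb2 tensor2M; congr tensor2; rewrite mulr1. Qed.

Lemma Delta_S n : Delta (Sg n) = \sum_(i < n.+1) tensor2 (Sg i) (Sg (n - i)).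
Proof. by apply: alg_extS; rewrite big_ord1 tensor2_11. Qed.

(* T(t) is a product of the grouplike series S(qt)^-1 and S(t). *)
Lemma Delta_T n : Delta (T n) = \sum_(i < n.+1) tensor2 (T i) (T (n - i)).
Proof.
have e: @Delta K \o T = cauchy (emb1 \o T) (emb2 \o T).
  apply: (@cauchy_quotientM _ _ q (emb1 \o Sg) (emb2 \o Sg) (@Delta K \o Sg)).
  - exact: Delta1.
  - apply: funext => m; apply: etrans (Delta_S m) _; apply: eq_bigr => i _.
    exact: (esym (tensor2_1r _ _)).
  - by move=> i j; exact: etrans (tensor2_1l _ _) (esym (tensor2_1r _ _)).
  - exact: dil_cauchy_morph emb1_linear emb1M dilS_T.
  - exact: dil_cauchy_morph emb2_linear emb2M dilS_T.
  - exact: dil_cauchy_morph (@Delta_linear K) DeltaM dilS_T.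
apply: etrans (congr1 (@^~ n) e) _; apply: eq_bigr => i _.
exact: tensor2_1r.
Qed.

End SymSeries.

(** * Internal product by T *)

Section Homogeneous.
Variable K : fieldType.
Implicit Types (f g : Sym K) (a b : nat -> Sym K) (w : word).

Lemma homogZ n s f : homog n f -> homog n (s *: f).
Proof. by move=> hf w /(fsubsetP (msuppZ_le _ _)); apply: hf. Qed.

Lemma homog1 : homog 0 (1 : Sym K).
Proof. exact: homogU wdeg1. Qed.

Lemma homog_S n : homog n (Sf K n).
Proof. by rewrite SE; apply/homogU/wdegS. Qed.

Lemma homog_cauchy a b n :
  (forall i, (i <= n)%N -> homog i (a i)) -> (forall i, (i <= n)%N -> homog i (b i)) ->
  homog n (cauchy a b n).
Proof.
move=> ha hb; apply: homog_sum => i _.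
have le : (i <= n)%N by rewrite -ltnS.
by rewrite -{1}(subnKC le); apply: homogM; [apply: ha|apply/hb/leq_subr].
Qed.

Lemma homog_lam n : homog n (lam K n).
Proof.
elim/ltn_ind: n => -[|n] IH; first by rewrite lam0; apply: homog1.
have e : Sf K n.+1 + \sum_(i < n) lam K i.+1 * Sf K (n - i) + lam K n.+1 = 0.
  exact: etrans (esym (cauchy_ends n (lam0 K) erefl)) (congr1 (@^~ n.+1) (lam_S K)).
have -> : lam K n.+1 = (-1) *: (Sf K n.+1 + \sum_(i < n) lam K i.+1 * Sf K (n - i)).
  by apply/eqP; rewrite scaleN1r -addr_eq0 addrC; apply/eqP.
apply/homogZ/homogD; first exact: homog_S.
apply: homog_sum => i _; have -> : n.+1 = (i.+1 + (n - i))%N by rewrite addSn subnKC // ltnW.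
by apply: homogM; [apply: IH; rewrite ltnS | apply: homog_S].
Qed.

Lemma homog_T q n : homog n (T (q : K) n).
Proof.
by apply: homog_cauchy => i _; [apply/homogZ/homog_lam | apply: homog_S].
Qed.

Lemma homog_theta q w : homog (wdeg w) (theta (q : K) << w >>).
Proof.
elim/word_ind: w => [|n w IH]; first by rewrite theta1 wdeg1; apply: homog1.
by rewrite -UM -SE thetaM theta_S wdegM wdegS; apply: homogM => //; apply: homog_T.
Qed.

Lemma hcompE n f : hcomp n f = lin (fun w => if wdeg w == n then << w >> else 0) f.
Proof.
rewrite /hcomp big_mkcond; apply: eq_bigr => w _.
case: eqP => _; last by rewrite scaler0.
apply/malgP => v; apply: etrans (mcoeffU _ _ _) _; apply: esym.
by apply: etrans (mcoeffZ _ _ _) _; rewrite mcoeffU1 mulr_natr.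
Qed.

Lemma hcomp_linear n : linear (@hcomp K n).
Proof. by move=> s f g; rewrite !hcompE linearP. Qed.

Lemma hcomp_homog n m f : homog m f -> hcomp n f = if m == n then f else 0.
Proof.
move=> hf; rewrite hcompE.
rewrite (lin_homog (h2 := fun w => if m == n then << w >> else 0) hf); last by move=> w ->.
by case: eqP => _; [rewrite [RHS](lin_id idfun f) | rewrite lin0].
Qed.

End Homogeneous.

Lemma mulr_mid (A : pzRingType) (a b c d : A) : a * b * (c * d) = a * (b * c) * d.
Proof. by rewrite !mulrA. Qed.

(** * The action of T through the twisted antipode *)

Section InternalProductByT.
Variables (K : fieldType) (q : K).
Implicit Types (f g h : Sym K) (a b : nat -> Sym K) (u v w x y : word).
Local Notation Sg := (Sf K).
Local Notation T := (T q).
Local Notation st := (@st K).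

Lemma st_deg n f w : homog n f -> wdeg w != n -> st f << w >> = 0.
Proof.
move=> hf ne; rewrite -[RHS](lin0 f); apply: (lin_homog hf) => u eu.
by rewrite linU; apply: starw_neq; rewrite eu; apply/eqP; rewrite eq_sym.
Qed.

Lemma st_S n f : st (Sg n) f = hcomp n f.
Proof. by rewrite hcompE SE /st linU; apply: eq_lin => v; rewrite starw_Sl. Qed.

(** The internal product of the formal sum of all [a n] with [w]: for homogeneous [a n], only the
    index [wdeg w] contributes. *)
Definition act a w : Sym K := st (a (wdeg w)) << w >>.

Lemma act_S w : act Sg w = << w >>.
Proof. by rewrite /act st_S (hcomp_homog _ (homogU (erefl (wdeg w)))) eqxx. Qed.

Lemma act_dil s a w : act (dil s a) w = s ^+ wdeg w *: act a w.
Proof.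
rewrite /act /dil -[_ *: a _]addr0 (st_linl << w >>).
by rewrite (linear0' (st_linl _)) addr0.
Qed.

Lemma act_cauchy a b w :
  (forall n, homog n (a n)) -> (forall n, homog n (b n)) ->
  act (cauchy a b) w = sumL w (fun x y => act a x * act b y).
Proof.
move=> ha hb; rewrite /act /cauchy (linear_big _ _ _ (st_linl _)).
under eq_bigr => i _ do rewrite st_split.
rewrite -sumL_sum; apply: sumL_deg => x y d.
(* For a given pair (x, y) of the splitting formula, only the summand of index deg x survives. *)
have lt : (wdeg x < (wdeg w).+1)%N by rewrite ltnS -d leq_addr.
rewrite (bigD1 (Ordinal lt)) //= big1 ?addr0 => [|i ne].
  by rewrite -d addKn.
rewrite (st_deg (ha i)) ?mul0r //; apply: contra ne => /eqP e.
exact/eqP/val_inj.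
Qed.

(** The antipode of the Hopf algebra [Sym]: the anti-morphism sending S_n to [lam K n], hence the
    reversed word. *)
Definition antipode w : Sym K := \prod_(i <- rev (w : seq nat)) lam K i.+1.

Lemma antipode1 : antipode mone = 1.
Proof. by rewrite /antipode fm1 big_nil. Qed.

Lemma antipodeM u v : antipode (mmul u v) = antipode v * antipode u.
Proof. by rewrite /antipode fmM rev_cat big_cat. Qed.

Lemma antipode_S n : antipode (Sw n) = lam K n.
Proof.
by case: n => [|n]; [rewrite antipode1 lam0 | rewrite /antipode fmU big_seq1].
Qed.

Lemma antipode_inverse w : sumL w (fun x y => antipode x * << y >>) = (w == mone)%:R.
Proof.
elim/word_ind: w => [|n w _]; first by rewrite sumL1 antipode1 eqxx mul1r.
have -> : (mmul (Sw n.+1) w == mone) = false.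
  by apply/negP; rewrite -wdeg_eq0 wdegM wdegS.
rewrite sumLS -sumL_sum -[RHS](sumL0 _ w); apply: eq_sumL => x y.
(* The antipode reverses products, so the two pieces of the first letter meet in the middle and form
   a coefficient of S(t)^-1 S(t). *)
transitivity (\sum_(i < n.+2) antipode x * (lam K i * Sg (n.+1 - i)) * << y >>).
  apply: eq_bigr => i _; rewrite antipodeM antipode_S -UM -SE; exact: mulr_mid.
rewrite -mulr_suml -mulr_sumr.
have -> : \sum_(i < n.+2) lam K i * Sg (n.+1 - i) = 0.
  exact: (congr1 (@^~ n.+1) (lam_S K)).
by rewrite mulr0 mul0r.
Qed.

(** The term with [y = mone] is [A w]; the others evaluate [A] in smaller degree, where induction
    applies. *)
Lemma convolution_inj (A B : word -> Sym K) :
  (forall w, sumL w (fun x y => A x * << y >>) = sumL w (fun x y => B x * << y >>)) ->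
  A =1 B.
Proof.
move=> e w; have [n] := ubnP (wdeg w); elim: n w => // n IH w ltw.
have e0 : sumL w (fun x y => A x * << y >> - B x * << y >>) = 0.
  by rewrite /sumL sumrB; apply/eqP; rewrite subr_eq0; apply/eqP/e.
apply/eqP; rewrite -subr_eq0 -(sumL_counitr w (fun x => A x - B x)) -[X in _ == X]e0.
apply/eqP; apply: sumL_deg => x y d.
have [->|ne] := eqVneq y mone; first by rewrite !mulr1.
rewrite -mulrBl IH ?subrr ?mul0r //; rewrite -ltnS; apply: leq_ltn_trans ltw.
by rewrite -d -[X in (X < _)%N]addn0 ltn_add2l lt0n wdeg_eq0.
Qed.

(** Both sides are convolution inverses of the identity, the left one because S(t)^-1 S(t) = 1 acts
    as the counit. *)
Lemma act_lam : act (lam K) =1 antipode.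
Proof.
apply: convolution_inj => w; apply: etrans (esym (antipode_inverse w)).
transitivity (act (cauchy (lam K) Sg) w).
  rewrite (act_cauchy _ (@homog_lam K) (@homog_S K)).
  by apply: eq_sumL => x y; rewrite act_S.
rewrite /act lam_S /series1 wdeg_eq0; case: eqP => [->|_].
  by rewrite st1 linU eqxx.
exact: linear0' (st_linl _).
Qed.

(** The action of S(qt)^-1 by internal product, in view of [act_dil] and [act_lam]. *)
Definition antipodeq w : Sym K := q ^+ wdeg w *: antipode w.

Lemma antipodeqM u v : antipodeq (mmul u v) = antipodeq v * antipodeq u.
Proof.
by rewrite /antipodeq wdegM antipodeM malgAr -scalerAl scalerA exprD.
Qed.

(* The linear map g |-> (sum_n T_n) * g, on words. *)
Definition starT w : Sym K := sumL w (fun x y => antipodeq x * << y >>).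

Lemma act_T w : act T w = starT w.
Proof.
rewrite act_cauchy => [|n|n]; [|exact/homogZ/homog_lam|exact: homog_S].
by apply: eq_sumL => x y; rewrite act_dil act_lam act_S.
Qed.

Lemma st_T n f : st (T n) f = lin starT (hcomp n f).
Proof.
move: f; apply: linear_ext => [||w]; first exact: st_linr.
  exact: (linear_comp (lin_is_linear _) (@hcomp_linear _ _)).
rewrite hcompE linU; case: eqP => [<-|/eqP ne]; first by rewrite linU -act_T.
by rewrite (st_deg (@homog_T K q n) ne) (linear0' (lin_is_linear _)).
Qed.

Lemma starT_S n : lin starT (Sg n) = T n.
Proof.
rewrite SE linU /starT -[Sw n]mulm1 sumLS; apply: eq_bigr => i _.
by rewrite sumL1 !mulm1 /antipodeq wdegS antipode_S SE.
Qed.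

(** [Delta] is multiplicative and [antipodeq] reverses products, so the sum for [g] stays intact
    between the two factors from [h]. *)
Lemma starT_mul g h :
  lin starT (g * h) =
  on2 (fun x y => lin antipodeq << x >> * lin starT g * << y >>) (Delta h).
Proof.
move: h; apply: linear_ext => [||v].
- exact: (linear_comp (lin_is_linear _) (mulr_linear_l _)).
- exact: (linear_comp (on2_linear _) (@Delta_linear _)).
rewrite on2_DeltaU; move: g; apply: linear_ext => [||u].
- exact: (linear_comp (lin_is_linear _) (mulr_linear_r _)).
- apply: linear_sumL => x y.
  exact: (linear_comp (mulr_linear_r _) (linear_comp (mulr_linear_l _) (lin_is_linear _))).
rewrite UM !linU /starT sumLM sumL_swap; apply: eq_sumL => x y; rewrite linU.
have l : linear (fun z => antipodeq x * z * << y >>).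
  exact: (linear_comp (mulr_linear_r _) (mulr_linear_l _)).
apply: etrans _ (esym (sumL_linear _ _ l)); apply: eq_sumL => s t.
rewrite antipodeqM -UM; exact: mulr_mid.
Qed.

End InternalProductByT.

(** * Stability under the internal product *)

Section StarClosure.
Variables (K : fieldType) (q : K).
Implicit Types (f g h : Sym K) (u v w x y : word).
Local Notation T := (T q).

Definition theta_word f : Prop := exists w, f = theta q << w >>.
Definition S_theta_word f : Prop := exists n w, f = Sf K n * theta q << w >>.
Local Notation Pr := (lspan theta_word).
Local Notation Pm := (lspan S_theta_word).

Lemma PringE f : Pring q f <-> Pr f.
Proof.
split=> [[g ->]|].
  by apply: lspan_malg => [|w]; [apply: theta_linear | apply: lspan_gen; exists w].
elim=> [|a _ g [w ->] _ [g' ->]]; first by exists 0; rewrite (linear0' (theta_linear q)).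
by exists (a *: << w >> + g'); rewrite theta_linear.
Qed.

Lemma PmodE f : Pmod q f <-> Pm f.
Proof.
split=> [[N [a [ha ->]]]|].
  apply: lspan_sum => n _; move/PringE: (ha n); apply: lspan_linear.
    exact: mulr_linear_l.
  by move=> _ [w ->]; apply: lspan_gen; exists n, w.
elim=> [|s _ g [n [w ->]] _ [N [a [ha ->]]]].
  exists 0%N, (fun=> 0); split=> [_|]; last by rewrite big_ord0.
  by apply/PringE/lspan0.
(* The new generator goes to index [n] and the old coefficients are padded by 0, up to a bound
   covering both. *)
pose b i := if i == n then theta q << w >> else 0.
pose c i := if (i < N)%N then a i else 0.
exists (maxn N n.+1), (fun i => s *: b i + c i); split=> [i|].
  apply/PringE/lspanP.
    by rewrite /b; case: eqP => _; [apply: lspan_gen; exists w | apply: lspan0].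
  by rewrite /c; case: ifP => _; [apply/PringE | apply: lspan0].
have eb : \sum_(i < maxn N n.+1) Sf K i * b i = Sf K n * theta q << w >>.
  rewrite (bigD1 (Ordinal (leq_maxr N n.+1))) //= {1}/b eqxx big1 ?addr0 // => i ne.
  rewrite /b ifN ?mulr0 //; apply: contra ne => /eqP e; exact/eqP/val_inj.
have ec : \sum_(i < maxn N n.+1) Sf K i * c i = \sum_(i < N) Sf K i * a i.
  rewrite (big_ord_widen _ (fun i => Sf K i * a i) (leq_maxl N n.+1)) [RHS]big_mkcond.
  by apply: eq_bigr => i _; rewrite /c; case: ifP => _; [by [] | exact: mulr0].
transitivity (s *: (\sum_(i < maxn N n.+1) Sf K i * b i) + \sum_(i < maxn N n.+1) Sf K i * c i).
  by rewrite eb ec.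
rewrite scaler_sumr -big_split; apply: eq_bigr => i _; exact/esym/mulr_linear_l.
Qed.

Lemma Pring_mul f g : Pr f -> Pr g -> Pr (f * g).
Proof.
apply: lspan_bilinear => [h|h|_ _ [u ->] [v ->]].
- exact: mulr_linear_r.
- exact: mulr_linear_l.
by apply: lspan_gen; exists (mmul u v); rewrite -UM thetaM.
Qed.

Lemma Pmod_mul f g : Pm f -> Pr g -> Pm (f * g).
Proof.
apply: lspan_bilinear => [h|h|_ _ [n [u ->]] [v ->]].
- exact: mulr_linear_r.
- exact: mulr_linear_l.
by apply: lspan_gen; exists n, (mmul u v); rewrite -mulrA -thetaM UM.
Qed.

Lemma Pring1 : Pr 1.
Proof. by apply: lspan_gen; exists mone; rewrite theta1. Qed.

Lemma Pring_T n : Pr (T n).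
Proof. by apply: lspan_gen; exists (Sw n); rewrite -SE theta_S. Qed.

Lemma Pmod_S n : Pm (Sf K n).
Proof. by apply: lspan_gen; exists n, mone; rewrite theta1 mulr1. Qed.

Lemma theta_word_ind (Q : Sym K -> Prop) :
  Q 1 -> (forall n f, Pr f -> Q f -> Q (T n * f)) -> forall w, Q (theta q << w >>).
Proof.
move=> Q1 QT; elim/word_ind=> [|n w IH]; first by rewrite theta1.
by rewrite -UM -SE thetaM theta_S; apply: QT => //; apply: lspan_gen; exists w.
Qed.

Lemma Delta_Pring f : Pr f -> tens Pr Pr (Delta f).
Proof.
apply: lspan_linear; first exact: Delta_linear.
move=> _ [w ->]; move: w; apply: (@theta_word_ind (fun f => tens Pr Pr (Delta f))) => [|n g _ IH].
  rewrite Delta1; apply: lspan_gen; exists 1, 1.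
  by split; [exact: Pring1|exact: Pring1|rewrite tensor2_11].
rewrite DeltaM; apply: tensM IH; [exact: Pring_mul|exact: Pring_mul|].
rewrite Delta_T; apply: lspan_sum => i _; apply: lspan_gen.
by exists (T i), (T (n - i)); split => //; apply: Pring_T.
Qed.

(** The tensor factors of [Delta] of S_n are again some S_i, and [Pm] absorbs [Pr] on the right. *)
Lemma Delta_Pmod f : Pm f -> tens Pm Pm (Delta f).
Proof.
apply: lspan_linear; first exact: Delta_linear.
move=> _ [n [w ->]]; rewrite DeltaM; apply: (tensM (@Pmod_mul) (@Pmod_mul)).
  rewrite Delta_S; apply: lspan_sum => i _; apply: lspan_gen.
  by exists (Sf K i), (Sf K (n - i)); split => //; apply: Pmod_S.
by apply: Delta_Pring; apply: lspan_gen; exists w.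
Qed.

Lemma lin_antipodeq_mul f g : lin (antipodeq q) (f * g) = lin (antipodeq q) g * lin (antipodeq q) f.
Proof.
move: f; apply: linear_ext => [||u].
- exact: (linear_comp (lin_is_linear _) (mulr_linear_r _)).
- exact: (linear_comp (mulr_linear_l _) (lin_is_linear _)).
move: g; apply: linear_ext => [||v].
- exact: (linear_comp (lin_is_linear _) (mulr_linear_l _)).
- exact: (linear_comp (mulr_linear_r _) (lin_is_linear _)).
by rewrite UM !linU antipodeqM.
Qed.

(** One bilinear map is evaluated on [Delta (T n)] twice: by [Delta_T], and by the antipode axiom,
    the weights q^deg of both factors multiplying to q^n. *)
Lemma antipodeq_T n :
  \sum_(i < n.+1) q ^+ (n - i) *: (lin (antipodeq q) (T i) * T (n - i)) = (n == 0)%:R.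
Proof.
pose dilw w : Sym K := q ^+ wdeg w *: << w >>.
pose phi f g := lin (antipodeq q) f * lin dilw g.
have phil g : linear (phi^~ g) by exact: (linear_comp (mulr_linear_r _) (lin_is_linear _)).
have phir f : linear (phi f) by exact: (linear_comp (mulr_linear_l _) (lin_is_linear _)).
have dilT m : lin dilw (T m) = q ^+ m *: T m.
  rewrite (lin_homog (h2 := fun w => q ^+ m *: << w >>) (homog_T (n := m))).
    move: (T m); apply: linear_ext => [|s f g|w]; first exact: lin_is_linear.
      by rewrite scalerDr !scalerA mulrC.
    by rewrite linU.
  by move=> w; rewrite /dilw => ->.
transitivity (on2 (fun u v => phi << u >> << v >>) (Delta (T n))).
  rewrite Delta_T (linear_big _ _ _ (on2_linear _)); apply: eq_bigr => i _.
  apply/esym/(etrans (on2_bilinear phil phir _ _)).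
  exact: etrans (congr1 _ (dilT _)) (malgAr _ _ _).
transitivity (lin (fun w => if w == mone then 1 else 0 : Sym K) (T n)).
  move: (T n); apply: linear_ext => [||w].
  - exact: (linear_comp (on2_linear _) (@Delta_linear _)).
  - exact: lin_is_linear.
  rewrite on2_DeltaU linU.
  transitivity (q ^+ wdeg w *: sumL w (fun x y => antipode K x * << y >>)).
    rewrite [in RHS]/sumL scaler_sumr.
    apply: (@sumL_deg _ w _ (fun x y => q ^+ wdeg w *: (antipode K x * << y >>))) => x y <-.
    by rewrite /phi !linU /antipodeq /dilw malgAr -scalerAl scalerA -exprD addnC.
  rewrite antipode_inverse.
  by case: eqP => [->|_]; rewrite ?wdeg1 ?expr0 ?scale1r // scaler0.
have hn : homog n (T n) by exact: homog_T.
rewrite (lin_homog (h2 := fun=> (n == 0%N)%:R : Sym K) hn) => [|w <-]; last first.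
  by rewrite wdeg_eq0; case: eqP.
case: eqP => [->|_]; last exact: lin0.
by rewrite T0 -[X in lin _ X]/(<< mone >>) linU.
Qed.

Lemma Pring_antipodeq f : Pr f -> Pr (lin (antipodeq q) f).
Proof.
apply: lspan_linear; first exact: lin_is_linear.
move=> _ [w ->]; move: w.
apply: (@theta_word_ind (fun f => Pr (lin (antipodeq q) f))) => [|n g _ IH].
  by rewrite -[X in lin _ X]/(<< mone >>) linU /antipodeq antipode1 wdeg1 scale1r; apply: Pring1.
rewrite lin_antipodeq_mul; apply: Pring_mul => // {g IH}.
(* Only the image of T_n remains to be treated. As T_0 = 1, it is the last term of [antipodeq_T],
   whose other terms have smaller indices. *)
elim/ltn_ind: n => n IH; move/eqP: (antipodeq_T n).
rewrite big_ord_recr /= subnn expr0 scale1r T0 mulr1 addrC eq_sym -subr_eq => /eqP <-.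
apply: lspanB; first by case: eqP => _; [apply: Pring1 | apply: lspan0].
apply: lspan_sum => i _; apply/lspanZ/Pring_mul; [exact: IH|exact: Pring_T].
Qed.

(** On S_n h with h in the image of theta_q, [starT_mul] gives terms antipodeq(h_1) T_n h_2 with all
    factors in that image. *)
Lemma Pmod_starT f : Pm f -> Pr (lin (starT q) f).
Proof.
apply: lspan_linear; first exact: lin_is_linear.
move=> _ [n [w ->]]; rewrite starT_mul starT_S.
have Dw : tens Pr Pr (Delta (theta q << w >>)).
  by apply: Delta_Pring; apply: lspan_gen; exists w.
apply: (lspan_on2 (phi := fun f g => lin (antipodeq q) f * T n * g) _ _ _ Dw) => [h|h|g h Pg Ph].
- exact: (linear_comp (mulr_linear_r _) (linear_comp (mulr_linear_r _) (lin_is_linear _))).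
- exact: mulr_linear_l.
by apply: Pring_mul => //; apply: Pring_mul; [apply: Pring_antipodeq | apply: Pring_T].
Qed.

Lemma homog_S_theta n w : homog (n + wdeg w) (Sf K n * theta q << w >>).
Proof. by apply: homogM; [apply: homog_S | apply: homog_theta]. Qed.

Lemma Pmod_hcomp n f : Pm f -> Pm (hcomp n f).
Proof.
apply: lspan_linear; first exact: hcomp_linear.
move=> _ [m [w ->]]; rewrite (hcomp_homog _ (@homog_S_theta m w)).
by case: eqP => _; [apply: lspan_gen; exists m, w | apply: lspan0].
Qed.

Lemma st_mul f1 f2 g :
  st (f1 * f2) g = on2 (fun x y => st f1 << x >> * st f2 << y >>) (Delta g).
Proof.
move: g; apply: linear_ext => [||w]; first exact: st_linr.
  exact: (linear_comp (on2_linear _) (@Delta_linear _)).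
by rewrite st_split on2_DeltaU.
Qed.

Lemma lspan_st (P Q G : Sym K -> Prop) f1 f2 g :
  (forall g1 g2, P g1 -> Q g2 -> lspan G (st f1 g1 * st f2 g2)) ->
  tens P Q (Delta g) -> lspan G (st (f1 * f2) g).
Proof.
move=> h; rewrite st_mul; apply: (lspan_on2 (phi := fun g1 g2 => st f1 g1 * st f2 g2)) => // x.
- exact: (linear_comp (mulr_linear_r _) (st_linr _)).
- exact: (linear_comp (mulr_linear_l _) (st_linr _)).
Qed.

(** Splitting peels off one T_n at a time, and T_n acts on g_1 as [starT] on a component of g_1. The
    empty product acts as the counit. *)
Lemma Pring_st f g : Pr f -> Pm g -> Pr (st f g).
Proof.
move=> Pf Pg; apply: (lspan_linear (st_linl g)) Pf => _ [w ->].
move: w g Pg; apply: (@theta_word_ind (fun f => forall g, Pm g -> Pr (st f g))) => [|n h _ IH] g Pg.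
  rewrite -[X in st X]/(<< mone >>) st1; apply: lspan_malg => [|w]; first exact: lin_is_linear.
  by rewrite linU; case: eqP => _; [apply: Pring1 | apply: lspan0].
apply: lspan_st (Delta_Pmod Pg) => g1 g2 P1 P2.
by apply: Pring_mul; [rewrite st_T; apply/Pmod_starT/Pmod_hcomp | apply: IH].
Qed.

(** The factor S_n extracts a component of g_1, which stays in [Pm]; the product of T's sends g_2
    into [Pr]. *)
Lemma Pmod_st f g : Pm f -> Pm g -> Pm (st f g).
Proof.
move=> Pf Pg; apply: (lspan_linear (st_linl g)) Pf => _ [n [w ->]].
apply: lspan_st (Delta_Pmod Pg) => g1 g2 P1 P2; apply: Pmod_mul.
  by rewrite st_S; apply: Pmod_hcomp.
by apply: Pring_st => //; apply: lspan_gen; exists w.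
Qed.

Lemma Pmod_subalgebra : unital_star_subalgebra (@st K) (Pmod q).
Proof.
split.
- exact/PmodE/lspan0.
- by move=> a f g /PmodE Pf /PmodE Pg; apply/PmodE/lspanP.
- by move=> n f /PmodE Pf; apply/PmodE/Pmod_hcomp.
- by move=> f g /PmodE Pf /PmodE Pg; apply/PmodE/Pmod_st.
- by move=> n; apply/PmodE/Pmod_S.
Qed.

End StarClosure.

(** * A basis of P *)

Section LeadingWord.
Variable K : fieldType.
Implicit Types (f g : Sym K) (u v w : word).

Definition long n f : Prop := forall w, w \in msupp f -> (n <= size w)%N.

Lemma long0 n : long n 0.
Proof. by move=> w; rewrite msupp0. Qed.

Lemma longD n f g : long n f -> long n g -> long n (f + g).
Proof.
by move=> hf hg w /(fsubsetP (msuppD_le f g)); rewrite in_fsetU => /orP[/hf|/hg].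
Qed.

Lemma longZ n a f : long n f -> long n (a *: f).
Proof. by move=> hf w /(fsubsetP (msuppZ_le _ _)); apply: hf. Qed.

Lemma long_sum n (I : Type) (s : seq I) (F : I -> Sym K) :
  (forall i, long n (F i)) -> long n (\sum_(i <- s) F i).
Proof. by move=> h; elim/big_ind: _ => //; [apply: long0 | apply: longD]. Qed.

Lemma longM m n f g : long m f -> long n g -> long (m + n) (f * g).
Proof.
move=> hf hg w /(fsubsetP (msuppM_incl _ _)) /imfset2P[x /= /hf lx] [y /= /hg ly] ->.
by rewrite fmM size_cat leq_add.
Qed.

Lemma longU n w : (n <= size w)%N -> long n (<< w >> : Sym K).
Proof. by move=> le x /(fsubsetP msuppU_le); rewrite in_fset1 => /eqP->. Qed.

Lemma long_le m n f : (m <= n)%N -> long n f -> long m f.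
Proof. by move=> le h w /h; apply: leq_trans. Qed.

Lemma long_homog n f : homog n.+1 f -> long 1 f.
Proof.
move=> hf w /hf; case: w => -[|i s] //=.
by rewrite /wdeg big_nil.
Qed.

(** Leading means shortest. The coefficient [a] may be 0, as happens for T_n when q^n = 1. *)
Definition leads f a u : Prop := exists2 g, long (size u).+1 g & f = a *: << u >> + g.

Lemma leads_long f a u : leads f a u -> long (size u) f.
Proof.
case=> g hg ->; apply: longD; first exact/longZ/longU.
exact: long_le hg.
Qed.

Lemma leadsM f a u g b v : leads f a u -> leads g b v -> leads (f * g) (a * b) (mmul u v).
Proof.
move=> [f' hf ef] lg; have hg := leads_long lg; case: lg => g' hg' eg.
exists (f' * g + a *: (<< u >> * g')).
  rewrite fmM size_cat; apply: longD; first by rewrite -addSn; apply: longM.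
  by rewrite -addnS; apply/longZ/longM => //; apply: longU.
rewrite {1}ef mulrDl {1}eg -scalerAl mulrDr malgAr UM scalerDr scalerA.
by rewrite -addrA [X in _ + X]addrC.
Qed.

Lemma leads1 : leads 1 1 mone.
Proof. by exists 0; [apply: long0 | rewrite scale1r addr0]. Qed.

Lemma leads_coef f a u v : leads f a u -> (size v <= size u)%N -> f@_v = a * (u == v)%:R.
Proof.
move=> [g hg ->] le; rewrite mcoeffD mcoeffZ mcoeffU1.
rewrite [g@_v]mcoeff_outdom ?addr0 //; apply/negP => /hg.
by rewrite ltnNge le.
Qed.

(** Triangularity by length: to the coefficient of [v], words at least as long contribute only
    through [v] itself, and shorter ones have [c w = 0] by induction. *)
Lemma leads_indep (b : word -> Sym K) (a : word -> K) (s : seq word) (c : word -> K) :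
  uniq s -> (forall w, w \in s -> a w != 0) -> (forall w, w \in s -> leads (b w) (a w) w) ->
  \sum_(w <- s) c w *: b w = 0 -> forall w, w \in s -> c w = 0.
Proof.
move=> us a0 lb e v; have [n] := ubnP (size v); elim: n v => // n IH v lt vs.
have {e} : \sum_(w <- s) c w * (b w)@_v = 0.
  rewrite -[RHS](@mcoeff0 _ K v) -e raddf_sum; apply: eq_bigr => w _.
  exact: esym (mcoeffZ _ _ _).
rewrite (bigD1_seq v) //=.
rewrite (leads_coef (lb v vs)) // eqxx mulr1 big_seq_cond big1 ?addr0.
  by move/eqP; rewrite mulf_eq0 (negPf (a0 v vs)) orbF => /eqP.
move=> w /andP[ws ne]; have [le|gt] := leqP (size v) (size w).
  by rewrite (leads_coef (lb w ws)) // (negPf ne) !mulr0.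
by rewrite IH ?mul0r // (leq_trans gt).
Qed.

End LeadingWord.

(** * Spanning, independence and graded dimensions of P *)

Section PmodBasis.
Variables (K : fieldType) (q : K) (r : nat).
Hypothesis hq : r.-primitive_root q.
Implicit Types (f g : Sym K) (u v w : word).
Local Notation T := (T q).

(** Coefficients of S(qt) T(t) = S(t), solved for the last T; every term on the right starts with
    some S_i, i > 0. *)
Lemma T_rec n : T n.+1 = (1 - q ^+ n.+1) *: Sf K n.+1
  - \sum_(i < n) q ^+ i.+1 *: (Sf K i.+1 * T (n - i)).
Proof.
have e : T n.+1 + \sum_(i < n) q ^+ i.+1 *: (Sf K i.+1 * T (n - i))
    + q ^+ n.+1 *: Sf K n.+1 = Sf K n.+1.
  apply: etrans (congr1 (@^~ n.+1) (dilS_T q)).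
  apply: etrans (esym (cauchy_ends n (dil0 _ _) (T0 q))).
  by under [in RHS]eq_bigr => i _ do rewrite -scalerAl.
by rewrite scalerBl scale1r -{1}e !addrK.
Qed.

(** The coefficients of T(q^(k-1) t) .. T(q t) T(t), that is, of S(q^k t)^-1 S(t). *)
Fixpoint dilprod (k : nat) : nat -> Sym K :=
  if k is k'.+1 then cauchy (dil (q ^+ k') T) (dilprod k') else series1.

(** Telescoping, by S(q^(k+1) t) T(q^k t) = S(q^k t). *)
Lemma S_dilprod k : cauchy (dil (q ^+ k) (Sf K)) (dilprod k) = Sf K.
Proof.
elim: k => [|k IH] /=; first by rewrite expr0 dil_1 cauchys1.
have e : cauchy (dil (q ^+ k.+1) (Sf K)) (dil (q ^+ k) T) = dil (q ^+ k) (Sf K).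
  rewrite exprSr -dil_dil; exact: etrans (esym (dil_cauchy _ _ _)) (congr1 _ (dilS_T q)).
by rewrite cauchyA e.
Qed.

Lemma dilprod_r : dilprod r = series1.
Proof.
have := S_dilprod r; rewrite (prim_expr_order hq) dil_1 => e.
exact: (@cauchyI _ _ (Sf K) _ _ erefl (etrans e (esym (cauchys1 _)))).
Qed.

Definition nmult (s : seq nat) := all (fun i => ~~ (r %| i.+1)%N) s.

Definition nmult_word f : Prop := exists2 w : word, nmult w & f = theta q << w >>.
Local Notation Pr := (lspan nmult_word).

Lemma nmult_mul f g : Pr f -> Pr g -> Pr (f * g).
Proof.
apply: lspan_bilinear => [h|h|_ _ [u hu ->] [v hv ->]].
- exact: mulr_linear_r.
- exact: mulr_linear_l.
apply: lspan_gen; exists (mmul u v); last by rewrite -UM thetaM.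
by rewrite fmM /nmult all_cat; apply/andP.
Qed.

Lemma nmult_1 : Pr 1.
Proof. by apply: lspan_gen; exists mone; rewrite ?fm1 // theta1. Qed.

(* If r divides n, the coefficient of t^n in
   T(q^(r-1) t) .. T(q t) T(t) = 1 is r T_n plus products of lower T's. *)
Lemma nmult_T n : Pr (T n).
Proof.
elim/ltn_ind: n => -[|n] IH; first by rewrite T0; apply: nmult_1.
have [dv|ndv] := boolP (r %| n.+1)%N; last first.
  apply: lspan_gen; exists (Sw n.+1); last by rewrite -SE theta_S.
  by rewrite fmU /nmult /= ndv.
(* In degree n + 1, T_(n+1) arises only when one factor T(q^j t) supplies the whole degree, with
   weight q^(j(n+1)); all else involves lower T's. *)
have low k : (forall m, (m <= n)%N -> Pr (dilprod k m)) /\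
    Pr (dilprod k n.+1 - (\sum_(j < k) (q ^+ j) ^+ n.+1) *: T n.+1).
  elim: k => [|k [IH1 IH2]] /=.
    rewrite big_ord0 scale0r subr0; split=> [m _|]; last exact: lspan0.
    by rewrite /series1; case: eqP => _; [apply: nmult_1 | apply: lspan0].
  split=> [m le|].
    apply: lspan_sum => i _; apply: nmult_mul.
      by apply/lspanZ/IH; apply: leq_trans (ltn_ord i) _.
    by apply: IH1; apply: leq_trans le; apply: leq_subr.
  have P0 : dilprod k 0 = 1.
    by elim: (k) => [|j] //= e; rewrite cauchy0 e mulr1 dil0 T0.
  have -> : cauchy (dil (q ^+ k) T) (dilprod k) n.+1 = dilprod k n.+1 +
      \sum_(i < n) dil (q ^+ k) T i.+1 * dilprod k (n - i)%N + (q ^+ k) ^+ n.+1 *: T n.+1.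
    by apply: cauchy_ends P0; rewrite dil0 T0.
  rewrite big_ord_recr scalerDl opprD addrACA subrr addr0 addrAC.
  apply: lspanD => //; apply: lspan_sum => i _; apply: nmult_mul.
    by apply/lspanZ/IH; rewrite ltnS.
  exact/IH1/leq_subr.
have [_] := low r; rewrite dilprod_r /series1 /= sub0r.
(* Since r divides n + 1, each weight is 1 and their sum is r, nonzero in [K] because q is a
   primitive r-th root of unity. *)
rewrite (eq_bigr (fun=> 1)) => [|j _]; last first.
  by apply/eqP; rewrite -exprM -(prim_order_dvd hq) dvdn_mull.
rewrite sumr_const card_ord => /(lspanZ (- r%:R^-1)).
by rewrite scalerN scaleNr opprK scalerA mulVf ?scale1r // (prim_root_natf_neq0 hq).
Qed.

Lemma nmult_theta w : Pr (theta q << w >>).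
Proof.
move: w; apply: (@theta_word_ind _ _ (fun f => Pr f)); first exact: nmult_1.
by move=> n f _ Pf; apply: nmult_mul => //; apply: nmult_T.
Qed.

(** The element S_i1 T_i2 .. T_ik for the word with parts i1, .., ik. *)
Definition bas w : Sym K :=
  if (w : seq nat) is i :: s then Sf K i.+1 * theta q << FMonom s >> else 1.

Definition admissible w : bool := nmult (behead w).

Lemma basM n w : bas (mmul (Sw n.+1) w) = Sf K n.+1 * theta q << w >>.
Proof.
by rewrite /bas fmM fmU /=; congr (_ * theta q << _ >>); apply/val_inj.
Qed.

Lemma bas1 : bas mone = 1.
Proof. by rewrite /bas fm1. Qed.

Definition admissible_bas f : Prop := exists2 w, admissible w & f = bas w.

Lemma admissible_S_nmult n f : Pr f -> lspan admissible_bas (Sf K n.+1 * f).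
Proof.
apply: lspan_linear; first exact: mulr_linear_l.
move=> _ [w hw ->]; apply: lspan_gen; exists (mmul (Sw n.+1) w); last by rewrite basM.
by rewrite /admissible fmM fmU.
Qed.

Lemma Pmod_admissible f : Pmod q f -> lspan admissible_bas f.
Proof.
move/PmodE; apply: lspan_sub => _ [[|n] [w ->]]; last first.
  exact/admissible_S_nmult/nmult_theta.
(* A generator with S_0 = 1 is a bare product of T's; [T_rec] makes its first factor start with some
   S_i. *)
rewrite mul1r; apply: lspan_sub (nmult_theta w) => _ [u hu ->] {w}.
elim/word_ind: u hu => [|n w _] hw.
  by apply: lspan_gen; exists mone; rewrite ?bas1 ?theta1 // /admissible fm1.
have {}hw : nmult w by move: hw; rewrite fmM fmU => /andP[].
have Pw : Pr (theta q << w >>) by apply: lspan_gen; exists w.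
rewrite -UM -SE thetaM theta_S T_rec mulrBl -scalerAl; apply: lspanB.
  by apply/lspanZ/admissible_S_nmult.
rewrite mulr_suml; apply: lspan_sum => i _; rewrite -scalerAl -mulrA.
by apply/lspanZ/admissible_S_nmult/nmult_mul => //; apply: nmult_T.
Qed.

Lemma Pmod_bas w : Pmod q (bas w).
Proof.
apply/PmodE; elim/word_ind: w => [|n w _].
  by rewrite bas1; apply: (Pmod_S q 0).
by rewrite basM; apply: lspan_gen; exists n.+1, w.
Qed.

Lemma homog_bas w : homog (wdeg w) (bas w).
Proof.
elim/word_ind: w => [|n w _]; first by rewrite bas1 wdeg1; apply: homog1.
by rewrite basM wdegM wdegS; apply: homog_S_theta.
Qed.

Lemma leads_S n : leads (Sf K n.+1) 1 (Sw n.+1).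
Proof. by exists 0; [apply: long0 | rewrite scale1r addr0 SE]. Qed.

(** The remaining terms of [T_rec] are products of two factors of positive degree, hence have at
    least two letters. *)
Lemma leads_T n : leads (T n.+1) (1 - q ^+ n.+1) (Sw n.+1).
Proof.
exists (- \sum_(i < n) q ^+ i.+1 *: (Sf K i.+1 * T (n - i))); last by rewrite -SE -T_rec.
rewrite fmU -scaleN1r; apply/longZ/long_sum => i; apply/longZ.
apply: (@longM _ 1 1); first exact: long_homog (homog_S (n := i.+1)).
by rewrite -[(n - i)%N]prednK ?subn_gt0 //; apply: long_homog (homog_T (n := _.+1)).
Qed.

Definition lead_coef_bas w : K := \prod_(i <- behead w) (1 - q ^+ i.+1).

Lemma leads_bas w : leads (bas w) (lead_coef_bas w) w.
Proof.
elim/word_ind: w => [|n w _].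
  by rewrite bas1 /lead_coef_bas fm1 big_nil; apply: leads1.
rewrite basM /lead_coef_bas fmM fmU /= -[X in leads _ X]mul1r.
apply: leadsM; first exact: leads_S.
elim/word_ind: w => [|m w IH]; first by rewrite theta1 fm1 big_nil; apply: leads1.
rewrite -UM -SE thetaM theta_S fmM fmU big_cons.
exact: leadsM (leads_T m) IH.
Qed.

Lemma lead_coef_bas_neq0 w : admissible w -> lead_coef_bas w != 0.
Proof.
move/allP=> hw; rewrite /lead_coef_bas prodf_seq_neq0; apply/allP => i /hw.
by rewrite (prim_order_dvd hq) subr_eq0 eq_sym.
Qed.

Lemma has_dim_Pmod n (s : seq word) :
  uniq s -> (forall w, (w \in s) = admissible w && (wdeg w == n)) ->
  has_dim (fun f => Pmod q f /\ homog n f) (size s).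
Proof.
move=> us ms; exists (fun i => bas (nth mone s i)); split.
- move=> i; split; first exact: Pmod_bas.
  have: nth mone s i \in s by apply: mem_nth.
  by rewrite ms => /andP[_ /eqP <-]; apply: homog_bas.
- move=> c e0 i.
  (* Moves the coefficients from positions to words, with default 0 off [s]. *)
  pose c' w := if insub (index w s) is Some j then c j else 0.
  have c'E (j : 'I_(size s)) : c' (nth mone s j) = c j.
    rewrite /c' index_uniq //; case: insubP => [k _ e|]; last by rewrite ltn_ord.
    by apply: congr1; apply/val_inj.
  rewrite -c'E.
  apply: (@leads_indep K bas lead_coef_bas s c' us) => [w|w _||].
  + by rewrite ms => /andP[/lead_coef_bas_neq0].
  + exact: leads_bas.
  + rewrite (big_nth mone) big_mkord -[RHS]e0; apply: eq_bigr => j _.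
    by rewrite c'E.
  exact: mem_nth.
- move=> f [Pf hf].
  have: lspan (fun x => exists2 w, w \in s & x = bas w) f.
    (* The projection to degree n fixes [f] and kills basis elements of other degrees. *)
    have -> : f = hcomp n f by rewrite (hcomp_homog _ hf) eqxx.
    apply: lspan_linear (Pmod_admissible Pf); first exact: hcomp_linear.
    move=> _ [w aw ->]; rewrite (hcomp_homog _ (homog_bas (w := w))).
    case: eqP => [e|_]; last exact: lspan0.
    by apply: lspan_gen; exists w; rewrite // ms aw e eqxx.
  case/(lspan_seq us) => c ->; exists (fun i => c (nth mone s i)).
  by rewrite (big_nth mone) big_mkord.
Qed.

End PmodBasis.

(** * The Hilbert series *)

Section Counting.
Variable r : nat.
Hypothesis r_gt0 : (0 < r)%N.

(* For n <= k (k is only fuel), the words of degree n whose parts i.+1 after the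
   first one are not multiples of r. *)
Fixpoint adm_seq (k n : nat) : seq (seq nat) :=
  if k is k'.+1 then
    if n is n'.+1 then
      [:: n'] :: [seq rcons s m | m <- [seq m <- iota 0 n' | ~~ (r %| m.+1)%N],
                                  s <- adm_seq k' (n' - m)]
    else [:: [::]]
  else [:: [::]].

Definition deg (s : seq nat) := (\sum_(i <- s) i.+1)%N.

Lemma deg_rcons s m : deg (rcons s m) = (deg s + m.+1)%N.
Proof. by rewrite /deg -cats1 big_cat big_seq1. Qed.

(** Words are split at the last letter: a single letter is unrestricted; otherwise the last letter
    follows a nonempty word and carries the condition. *)
Lemma mem_adm_seq k n s : (n <= k)%N ->
  (s \in adm_seq k n) = nmult r (behead s) && (deg s == n).
Proof.
elim: k n s => [|k IH] [|n] s //= le.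
- rewrite inE; case: s => [|i s]; first by rewrite /deg big_nil eqxx.
  by rewrite /deg big_cons addSn andbF.
- rewrite inE; case: s => [|i s]; first by rewrite /deg big_nil eqxx.
  by rewrite /deg big_cons addSn andbF.
rewrite inE; apply/idP/idP.
  case/orP=> [/eqP->|]; first by rewrite /deg big_seq1 eqxx.
  case/allpairsPdep=> m [t [+ + ->]]; rewrite mem_filter mem_iota /= add0n => /andP[ndv lt].
  rewrite IH ?(leq_trans (leq_subr _ _)) // deg_rcons => /andP[ht /eqP dt].
  rewrite dt addnS subnK ?eqxx ?andbT ?(ltnW lt) //.
  case: t ht dt => [_|i t /=]; first by rewrite /deg big_nil => /esym/eqP; rewrite subn_eq0 leqNgt lt.
  by rewrite /nmult all_rcons ndv => ->.
case/lastP: s => [|t m]; first by rewrite /deg big_nil andbC.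
rewrite deg_rcons addnS eqSS => /andP[ht /eqP dt].
case: t ht dt => [_|i t /=]; first by rewrite /deg big_nil add0n => ->; rewrite eqxx.
rewrite /nmult all_rcons => /andP[ndv ht] dt; apply/orP; right.
have lt : (m < n)%N by rewrite -dt /deg big_cons addSn ltnS leq_addl.
apply/allpairsPdep; exists m, (i :: t); split=> //.
  by rewrite mem_filter mem_iota ndv.
rewrite IH ?(leq_trans (leq_subr _ _)) //= -dt addnK eqxx andbT.
exact: ht.
Qed.

Lemma adm_seq_uniq k n : (n <= k)%N -> uniq (adm_seq k n).
Proof.
elim: k n => [|k IH] [|n] //= le; apply/andP; split.
  apply/negP => /allpairsPdep[m [t [+ + e]]]; rewrite mem_filter mem_iota /= add0n.
  case/andP=> _ lt; rewrite mem_adm_seq ?(leq_trans (leq_subr _ _)) // => /andP[_ /eqP dt].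
  move/(congr1 size): e dt; rewrite size_rcons => -[/esym/size0nil ->].
  by rewrite /deg big_nil => /esym/eqP; rewrite subn_eq0 leqNgt lt.
apply: allpairs_uniq_dep.
- exact/filter_uniq/iota_uniq.
- by move=> m _; apply: IH; apply: leq_trans (leq_subr _ _) _.
- by move=> [m s] [m' s'] _ _ /= /rcons_inj[-> ->].
Qed.

Definition adm_count n := size (adm_seq n n).

Lemma size_adm_seq k n : (n <= k)%N -> size (adm_seq k n) = adm_count n.
Proof.
move=> le; apply/perm_size/uniq_perm; [exact: adm_seq_uniq|exact: adm_seq_uniq|].
by move=> s; rewrite !mem_adm_seq.
Qed.

Local Notation d := adm_count.

(** For n > 0, the one-letter word is counted by the term m = n - 1 if r does not divide n, as
    [d 0 = 1], and by the first summand otherwise. *)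
Lemma adm_count_rec n :
  d n = ((r %| n) + \sum_(m < n | ~~ (r %| m.+1)) d (n - m.+1))%N.
Proof.
case: n => [|n]; first by rewrite big_ord0 dvdn0.
rewrite /d /= size_allpairs_dep sumnE big_map big_filter.
have -> : iota 0 n = index_iota 0 n by rewrite /index_iota subn0.
rewrite big_mkord big_mkcond [in RHS]big_mkcond big_ord_recr /= subnn.
rewrite addnCA -[LHS]addn1; congr (_ + _)%N.
  apply: eq_bigr => m _; case: ifP => // _; rewrite subSS size_adm_seq //.
  exact: leq_subr.
by case: (r %| _)%N.
Qed.

Lemma adm_count_lt n : (n < r)%N -> d n = ((n == 0) + \sum_(m < n) d (n - m.+1))%N.
Proof.
move=> lt; rewrite adm_count_rec; congr (_ + _)%N.
  by case: n lt => [|n] lt; [rewrite dvdn0 | rewrite gtnNdvd].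
by apply: eq_bigl => m; rewrite gtnNdvd // (leq_ltn_trans _ lt).
Qed.

(** The terms with m >= r and the divisibility summand form the recursion for n - r; the resulting
    [d (n - r)] fills the gap at m = r - 1. *)
Lemma adm_count_ge n : (r <= n)%N -> d n = (\sum_(m < r) d (n - m.+1))%N.
Proof.
move=> le; rewrite adm_count_rec.
rewrite -(big_mkord (fun m => ~~ (r %| m.+1)%N) (fun m => d (n - m.+1)%N)).
rewrite (big_cat_nat (n := r)) //= addnCA.
have -> : (\sum_(r <= m < n | ~~ (r %| m.+1)) d (n - m.+1) =
           \sum_(m < n - r | ~~ (r %| m.+1)) d (n - r - m.+1))%N.
  rewrite -{1}[r]add0n big_addn big_mkord; apply: eq_big => m.
    by rewrite -addSn dvdn_addl.
  by move=> _; rewrite -addSn addnC subnDA.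
rewrite -(dvdn_subl le (dvdnn r)) -adm_count_rec big_mkord.
case: r r_gt0 le => // s _ le; rewrite big_mkcond !big_ord_recr /= dvdnn addn0.
congr (_ + _)%N; apply: eq_bigr => m _; rewrite ifT // gtnNdvd //.
by rewrite ltnS.
Qed.

Lemma coef_unit_sub_geom (A : nzRingType) j :
  (1 - \sum_(1 <= k < r.+1) 'X^k : {poly A})`_j = (j == 0%N)%:R - ((0 < j) && (j <= r))%N%:R.
Proof.
rewrite coefB coef1 coef_sum; congr (_ - _).
under eq_bigr => k _ do rewrite coefXn.
have [jr|njr] := boolP ((0 < j) && (j <= r))%N.
  rewrite (bigD1_seq j) ?mem_index_iota ?iota_uniq //= eqxx big1 ?addr0 // => k ne.
  by rewrite eq_sym (negPf ne).
rewrite big_seq big1 // => k; rewrite mem_index_iota ltnS.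
by case: eqP => // <- e; rewrite e in njr.
Qed.

Lemma adm_count_series :
  is_series_inverse (fun n => (d n)%:Z) (1 - \sum_(1 <= k < r.+1) 'X^k).
Proof.
move=> n; rewrite /series_mul (reindex_inj rev_ord_inj) /=.
transitivity (\sum_(j < n.+1) (d (n - j))%:Z *
    ((j == 0%N :> nat)%:R - ((0 < j) && (j <= r))%N%:R)).
  apply: eq_bigr => j _; rewrite subSS subKn; last by rewrite -ltnS.
  by rewrite /series_poly coef_unit_sub_geom.
rewrite big_ord_recl subn0 /= subr0 mulr1.
have -> : \sum_(i < n) (d (n - bump 0 i))%:Z *
      ((bump 0 i == 0%N)%:R - (bump 0 i <= r)%N%:R) =
    - (\sum_(i < n | (i < r)%N) d (n - i.+1))%N%:Z.
  rewrite (big_morph Posz PoszD erefl) [in RHS]big_mkcond -sumrN.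
  apply: eq_bigr => i _; rewrite /bump /= add1n sub0r.
  by case: (_ <= _)%N; rewrite ?mulrN1 ?oppr0 ?mulr0.
(* The coefficient is [d n] minus the sum of at most r preceding values, so each range of n is one
   form of the recursion. *)
rewrite [RHS]coef1; have [lt|le] := ltnP n r.
  have -> : (\sum_(i < n | i < r) d (n - i.+1) = \sum_(i < n) d (n - i.+1))%N.
    by apply: eq_bigl => i; rewrite (ltn_trans (ltn_ord i) lt).
  by rewrite adm_count_lt // PoszD addrK; case: (n == 0%N).
rewrite adm_count_ge // (big_ord_widen n (fun i => d (n - i.+1)%N) le) subrr.
by rewrite gtn_eqF // (leq_trans r_gt0).
Qed.

End Counting.

(** * Dimensions of the graded components *)

Section HilbertSeries.
Variables (K : fieldType) (q : K) (r : nat).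
Hypothesis hq : r.-primitive_root q.

Lemma has_dim_adm_count n :
  has_dim (fun f : Sym K => Pmod q f /\ homog n f) (adm_count r n).
Proof.
have e w : (w \in map (@FMonom nat) (adm_seq r n n)) = admissible r w && (wdeg w == n).
  case: w => s; rewrite mem_map => [|s1 s2 []//].
  by rewrite mem_adm_seq.
rewrite /adm_count -(size_map (@FMonom nat)).
apply: (has_dim_Pmod hq) => //; rewrite map_inj_uniq ?adm_seq_uniq //.
by move=> s1 s2 [].
Qed.

End HilbertSeries.

(** Stability is proved for the explicit product [st]; its axioms let uniqueness transfer the result
    to any [star]. *)
Lemma st_internal_product (K : fieldType) : is_internal_product (@st K).
Proof.
split.
- exact: st_linl.
- exact: st_linr.
- exact: st_assoc.
- move=> m n f g hf hg ne; rewrite -[RHS](lin0 f); apply: (lin_homog hf) => u eu.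
  rewrite -[RHS](lin0 g); apply: (lin_homog hg) => v ev.
  by apply: starw_neq; rewrite eu ev.
- by move=> n g hg; rewrite st_S (hcomp_homog _ hg) eqxx.
- move=> n f hf; rewrite SE /st [RHS](lin_id idfun f).
  by apply: (lin_homog hf) => u eu; rewrite linU starw_Sr eu eqxx.
- exact: st_splitting.
Qed.

Theorem theorem4p1 (R : realType) (r : nat) (q : R[i])
    (star : Sym R[i] -> Sym R[i] -> Sym R[i])
    (hr : (1 <= r)%N) (hq : r.-primitive_root q)
    (hstar : is_internal_product star) :
  unital_star_subalgebra star (Pmod q) /\
  exists d : nat -> nat,
    (forall n, has_dim (fun f : Sym R[i] => Pmod q f /\ homog n f) (d n)) /\
    is_series_inverse (fun n => (d n)%:Z) (1 - \sum_(1 <= k < r.+1) 'X^k).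
Proof.
split.
  have -> : star = @st R[i].
    apply: funext => f; apply: funext => g.
    exact: internal_product_unique hstar (st_internal_product _) f g.
  exact: Pmod_subalgebra.
exists (adm_count r); split; last exact: adm_count_series.
by move=> n; apply: has_dim_adm_count.
Qed.
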